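(* Let $\mathcal{X}$ and $\mathcal{Y}$ be Polish spaces. The following are equivalent: (1) $\omega\times\mathcal{X}$ and $\omega\times\mathcal{Y}$ are first-level Borel isomorphic; (2) there is an oracle $\alpha\in 2^\omega$ (relative to which $\mathcal{X}$ and $\mathcal{Y}$ are $\alpha$-computable Polish spaces) such that $\mathcal{D}^\alpha_{tt}(\mathcal{X})=\mathcal{D}^\alpha_{tt}(\mathcal{Y})$.
   Context: A function $f\colon\mathcal{X}\to\mathcal{Y}$ between topological spaces is a first-level Borel function if $f^{-1}[A]$ is $F_\sigma$ for every $F_\sigma$ set $A\subseteq\mathcal{Y}$. A first-level Borel isomorphism is a bijection $f$ such that both $f$ and $f^{-1}$ are first-level Borel functions. For an oracle $\alpha$, an $\alpha$-computable metric space is a triple $(X,d,(a_n)_{n})$ with $(X,d)$ separable metric, $(a_n)$ dense, and $(m,n)\mapsto d(a_m,a_n)$ computable relative to $\alpha$ (an $\alpha$-computable Polish space if $(X,d)$ is complete). A name of $x$ is $p\in\omega^\omega$ with $d(a_{p(n)},a_{p(m)})<2^{-n}$ for all $m\ge n$ and $a_{p(n)}\to x$. A partial function $f\colon\subseteq X\to Y$ is $\alpha$-computable if some partial $\alpha$-computable $\Phi\colon\subseteq\omega^\omega\to\omega^\omega$ sends every name of every $x\in\mathrm{dom}(f)$ to a name of $f(x)$. A $\Pi^0_1(\alpha)$ set is the complement of a union of an $\alpha$-computable sequence of rational open balls $B_r(a_n)$ ($r$ rational). For points $x\in\mathcal{X}$, $y\in\mathcal{Y}$ of $\alpha$-computable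 metric spaces, $y\le^\alpha_{tt}x$ means there is a partial $\alpha$-computable $f\colon\subseteq\mathcal{X}\to\mathcal{Y}$ whose domain is $\Pi^0_1(\alpha)$, with $x\in\mathrm{dom}(f)$ and $f(x)=y$; $\equiv^\alpha_{tt}$ is the induced equivalence on points of all such spaces, and $\mathcal{D}^\alpha_{tt}(\mathcal{X})$ is the set of $\equiv^\alpha_{tt}$-classes of points of $\mathcal{X}$ (so $\mathcal{D}^\alpha_{tt}(\mathcal{X})=\mathcal{D}^\alpha_{tt}(\mathcal{Y})$ means every point of $\mathcal{X}$ is $\equiv^\alpha_{tt}$ to a point of $\mathcal{Y}$ and vice versa). *)

(* Defs.v *)
From HB Require Import structures.
From mathcomp Require Import all_boot all_order all_algebra.
From mathcomp Require Import all_classical all_reals topology borel_hierarchy.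

Set Implicit Arguments.
Unset Strict Implicit.
Unset Printing Implicit Defensive.

Import Order.TTheory GRing.Theory Num.Theory.

Local Open Scope classical_set_scope.
Local Open Scope ring_scope.

(* Kleene's mu-recursive functions, with one extra unary basic function for
   the oracle. *)
Inductive code : Type :=
| Zero
| Succ
| Proj of nat
| Oracle
| Comp of code & seq code
| PrimRec of code & code
| Mu of code.

(* [eval O c v r]: the partial function coded by [c], with oracle [O], is
   defined on the argument list [v] and has value [r] there. *)
Inductive eval (O : nat -> nat) : code -> seq nat -> nat -> Prop :=
| eval_Zero v : eval O Zero v 0%N
| eval_Succ n v : eval O Succ (n :: v) n.+1
| eval_Proj i v : (i < size v)%N -> eval O (Proj i) v (nth 0%N v i)
| eval_Oracle n v : eval O Oracle (n :: v) (O n)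
| eval_Comp f gs v w r :
    evals O gs v w -> eval O f w r -> eval O (Comp f gs) v r
| eval_PrimRec0 f g v r :
    eval O f v r -> eval O (PrimRec f g) (0%N :: v) r
| eval_PrimRecS f g n v s r :
    eval O (PrimRec f g) (n :: v) s -> eval O g [:: n, s & v] r ->
    eval O (PrimRec f g) (n.+1 :: v) r
| eval_Mu f v n (k : nat -> nat) :
    (forall m, (m < n)%N -> eval O f (m :: v) (k m).+1) ->
    eval O f (n :: v) 0%N -> eval O (Mu f) v n
with evals (O : nat -> nat) : seq code -> seq nat -> seq nat -> Prop :=
| evals_nil v : evals O [::] v [::]
| evals_cons g gs v x w :
    eval O g v x -> evals O gs v w -> evals O (g :: gs) v (x :: w).

Definition cantor_oracle (alpha : nat -> bool) : nat -> nat :=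
  fun n => nat_of_bool (alpha n).

(* The join of alpha (on even numbers) and p (on odd numbers). *)
Definition join_oracle (alpha : nat -> bool) (p : nat -> nat) : nat -> nat :=
  fun n => if odd n then p n./2 else nat_of_bool (alpha n./2).

Definition computable1 (alpha : nat -> bool) (f : nat -> nat) : Prop :=
  exists c, forall n, eval (cantor_oracle alpha) c [:: n] (f n).

Definition computable3 (alpha : nat -> bool) (f : nat -> nat -> nat -> nat) :
    Prop :=
  exists c, forall l m n, eval (cantor_oracle alpha) c [:: l; m; n] (f l m n).

(* [Phi alpha c p q]: the partial alpha-computable functional on Baire space
   with index [c] is defined at [p] and maps it to [q]. *)
Definition Phi (alpha : nat -> bool) (c : code) (p q : nat -> nat) : Prop :=
  forall n, eval (join_oracle alpha p) c [:: n] (q n).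

Section metric.
Context {R : realType} {X : topologicalType}.
Implicit Type d : X -> X -> R.

Definition is_metric d : Prop :=
  [/\ forall x y, 0 <= d x y,
      forall x y, d x y = 0 <-> x = y,
      forall x y, d x y = d y x &
      forall x y z, d x z <= d x y + d y z].

Definition compatible d : Prop :=
  forall x : X, nbhs x = filter_from [set e : R | 0 < e]
                                     (fun e => [set y | d x y < e]).

Definition complete_metric d : Prop :=
  forall u : nat -> X,
    (forall e, 0 < e -> exists N,
       forall m n, (N <= m)%N -> (N <= n)%N -> d (u m) (u n) < e) ->
    exists l : X, u @ \oo --> l.

End metric.

Definition polish (R : realType) (X : topologicalType) : Prop :=
  (exists d : X -> X -> R, [/\ is_metric d, compatible d & complete_metric d])
  /\ (exists2 A : set X, countable A & dense A).

Record presentation (R : realType) (X : topologicalType) := Presentation {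
  dist : X -> X -> R ;
  pt : nat -> X }.

Section computable_metric.
Context {R : realType} (alpha : nat -> bool).

(* A double sequence of (nonnegative) reals is computable if rational
   approximations num / (den + 1) with error < 2^-k can be computed. *)
Definition computable_dist {X : topologicalType} (P : presentation R X) : Prop :=
  exists num den : nat -> nat -> nat -> nat,
    [/\ computable3 alpha num, computable3 alpha den &
        forall m n k,
          `|dist P (pt P m) (pt P n) - (num m n k)%:R / (den m n k).+1%:R|
            < 2 ^- k].

Definition computable_metric_space {X : topologicalType}
    (P : presentation R X) : Prop :=
  [/\ is_metric (dist P), compatible (dist P), dense (range (pt P)) &
      computable_dist P].

Definition computable_polish_space {X : topologicalType}
    (P : presentation R X) : Prop :=
  computable_metric_space P /\ complete_metric (dist P).

Definition is_name {X : topologicalType} (P : presentation R X)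
    (p : nat -> nat) (x : X) : Prop :=
  (forall n m, (n <= m)%N -> dist P (pt P (p n)) (pt P (p m)) < 2 ^- n) /\
  (pt P \o p) @ \oo --> x.

(* A partial function is given by its domain [D] and a total function [f],
   the values of which outside [D] are irrelevant. *)
Definition computable_on {X Y : topologicalType}
    (P : presentation R X) (Q : presentation R Y)
    (D : set X) (f : X -> Y) : Prop :=
  exists c, forall x, D x -> forall p, is_name P p x ->
    exists2 q, Phi alpha c p q & is_name Q q (f x).

(* The radii are num k / (den k + 1); radius 0 gives the empty ball, so that
   the whole space is Pi^0_1. *)
Definition Pi01 {X : topologicalType} (P : presentation R X) (D : set X) : Prop :=
  exists center num den : nat -> nat,
    [/\ computable1 alpha center, computable1 alpha num, computable1 alpha den &
        D = ~` \bigcup_k [set x | dist P (pt P (center k)) x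
                                    < (num k)%:R / (den k).+1%:R]].

Definition tt_le {X Y : topologicalType}
    (Q : presentation R Y) (y : Y) (P : presentation R X) (x : X) : Prop :=
  exists (D : set X) (f : X -> Y),
    [/\ Pi01 P D, computable_on P Q D f, D x & f x = y].

Definition tt_equiv {X Y : topologicalType}
    (P : presentation R X) (x : X) (Q : presentation R Y) (y : Y) : Prop :=
  tt_le P x Q y /\ tt_le Q y P x.

Definition same_tt_degrees {X Y : topologicalType}
    (P : presentation R X) (Q : presentation R Y) : Prop :=
  (forall x, exists y, tt_equiv P x Q y) /\
  (forall y, exists x, tt_equiv P x Q y).

End computable_metric.

Definition first_level_Borel {X Y : topologicalType} (f : X -> Y) : Prop :=
  forall A : set Y, Fsigma A -> Fsigma (f @^-1` A).

Definition first_level_Borel_isomorphic (X Y : topologicalType) : Prop :=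
  exists (f : X -> Y) (g : Y -> X),
    [/\ cancel f g, cancel g f, first_level_Borel f & first_level_Borel g].

(* Main.v *)
Require Import Defs.
From HB Require Import structures.
From mathcomp Require Import all_boot all_order all_algebra.
From mathcomp Require Import all_classical all_reals topology borel_hierarchy.
From mathcomp Require Import lra.

Set Implicit Arguments.
Unset Strict Implicit.
Unset Printing Implicit Defensive.

Import Order.TTheory GRing.Theory Num.Theory.

Local Open Scope classical_set_scope.
Local Open Scope ring_scope.

(* From (1) to (2): by the Jayne-Rogers theorem, a first-level Borel function is
   continuous on each piece of a countable closed cover. It is only needed for
   injective functions f, for which there is a short proof. If f is continuous on
   no nonempty open part of a closed set K, Baire's theorem gives a sequence in K
   that is dense in itself and on which the values of f form a discrete set. This
   set is both F_sigma and G_delta, hence so is its preimage, the set of points of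
   the sequence, contradicting Baire's theorem again. An oracle then encodes the
   metrics, the closed pieces and moduli of continuity of the countably many
   restrictions.

   From (2) to (1): there are countably many truth-table reductions, and they are
   continuous with closed domains, so X and Y have countable closed covers (A_n)
   and (B_n) with homeomorphisms h_n from A_n to B_n. Repeat each piece infinitely
   often in these families. Then (j, x) is mapped to (i, h_n x), where A_n is the
   j-th piece containing x and B_n is the i-th piece containing h_n x. *)

(* These names are shadowed by mathcomp-analysis. *)
Local Notation code := Defs.code.
Local Notation eval := Defs.eval.
Local Notation evals := Defs.evals.

(** * F_sigma sets and Baire's theorem in metric spaces *)

Section Fsigma_theory.
Context {T : topologicalType}.
Implicit Types A B : set T.

Lemma Fsigma_bigcup (I : countType) (F : I -> set T) :
  (forall i, Fsigma (F i)) -> Fsigma (\bigcup_i F i).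
Proof.
move=> /(_ _)/cid2-/all_sig2[C clC FC].
exists (fun k => if unpickle k is Some (i, n) then C i n else set0).
  by move=> k; case: unpickle => [[i n]|]; [exact: clC|exact: closed0].
apply/seteqP; split=> [x [i _]|x [k _]].
  by rewrite FC => -[n _ Cx]; exists (pickle (i, n)); rewrite // pickleK.
by case: unpickle => // -[i n] Cx; exists i => //; rewrite FC; exists n.
Qed.

Lemma FsigmaU A B : Fsigma A -> Fsigma B -> Fsigma (A `|` B).
Proof.
move=> FA FB.
suff -> : A `|` B = \bigcup_b (if b then A else B) by apply: Fsigma_bigcup; case.
apply/seteqP; split=> [x []|x [[] _]]; [by exists true|by exists false|..].
  by left.
by right.
Qed.

Lemma FsigmaI A B : Fsigma A -> Fsigma B -> Fsigma (A `&` B).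
Proof.
move=> [F clF ->] [G clG ->].
suff -> : \bigcup_i F i `&` \bigcup_i G i =
    \bigcup_(p : nat * nat) (F p.1 `&` G p.2).
  by apply: Fsigma_bigcup => p; apply: closed_Fsigma; apply: closedI.
apply/seteqP; split=> [x [[i _ Fx] [j _ Gx]]|x [[i j] _ [Fx Gx]]].
  by exists (i, j).
by split; [exists i|exists j].
Qed.

End Fsigma_theory.

Lemma half_pow_lt (R : realType) (e : R) : 0 < e -> exists n, 2 ^- n < e.
Proof.
move=> e0; exists (Num.bound e^-1).
have lt_n n : n%:R < 2 ^+ n :> R by rewrite -natrX ltr_nat ltn_expl.
have e_gt0 : 0 < e^-1 by rewrite invr_gt0.
rewrite -[ltRHS]invrK ltf_pV2 ?posrE ?exprn_gt0//.
exact: lt_trans (archi_boundP (ltW e_gt0)) (lt_n _).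
Qed.

Lemma pow_half_gt0 {R : realType} n : 0 < 2 ^- n :> R.
Proof. by rewrite invr_gt0 exprn_gt0. Qed.

Lemma pow_halfS {R : realType} n : 2 ^- n = 2 ^- n.+1 + 2 ^- n.+1 :> R.
Proof. by rewrite exprS invfM; lra. Qed.

Lemma pow_half_le {R : realType} m n : (m <= n)%N -> 2 ^- n <= 2 ^- m :> R.
Proof. by move=> mn; rewrite lef_pV2 ?posrE ?exprn_gt0// ler_eXn2l ?ltr1n. Qed.

(** Takes every value infinitely often. It serves to return to each point of a sequence, and to
    repeat each piece of a cover. *)
Definition schedule n := head 0%N (CodeSeq.decode n).

Lemma schedule_infinite k N :
  exists n, [/\ (k < n)%N, (N < n)%N & schedule n = k].
Proof.
(* A sequence code exceeds all its entries; the second entry [N] is there only to make the code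
   large. *)
exists (CodeSeq.code [:: k; N]); rewrite /schedule CodeSeq.codeK.
by have /and3P[] := CodeSeq.ltn_code [:: k; N].
Qed.

Section metric_topology.
Context {R : realType} {X : topologicalType} (d : X -> X -> R).
Hypotheses (dm : is_metric d) (dc : compatible d).
Implicit Types (x y z : X) (A K : set X) (e r s : R).

Lemma dist_ge0 x y : 0 <= d x y. Proof. by case: dm. Qed.
Lemma distxx x : d x x = 0. Proof. by case: dm => _ /(_ x x) [_ ->]. Qed.
Lemma dist0_eq x y : d x y = 0 -> x = y.
Proof. by case: dm => _ /(_ x y) []. Qed.
Lemma distC x y : d x y = d y x. Proof. by case: dm. Qed.
Lemma dist_triangle y x z : d x z <= d x y + d y z.
Proof. by case: dm => _ _ _; apply. Qed.

Lemma dist_gt0 x y : x <> y -> 0 < d x y.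
Proof.
move=> xy; rewrite lt_neqAle dist_ge0 andbT eq_sym.
by apply/eqP => /dist0_eq.
Qed.

Lemma nbhs_distP x A :
  nbhs x A <-> exists2 e, 0 < e & forall y, d x y < e -> A y.
Proof. by rewrite dc; split=> -[e]; exists e. Qed.

Lemma open_distP A :
  open A <-> forall x, A x -> exists2 e, 0 < e & forall y, d x y < e -> A y.
Proof.
rewrite openE; split=> Ao x Ax; first by apply/nbhs_distP; exact: Ao.
by apply/nbhs_distP; exact: Ao.
Qed.

Lemma closure_distP A x :
  closure A x <-> forall e, 0 < e -> exists2 y, A y & d x y < e.
Proof.
split=> [clA e e0|clA V /nbhs_distP[e e0 eV]].
  have [|y [Ay xy]] := clA [set y | d x y < e]; last by exists y.
  by apply/nbhs_distP; exists e.
by have [y Ay /eV Vy] := clA _ e0; exists y.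
Qed.

Lemma closed_distP A :
  closed A <->
  forall x, (forall e, 0 < e -> exists2 y, A y & d x y < e) -> A x.
Proof.
by split=> clA x => [/closure_distP|/closure_distP]; apply: clA.
Qed.

Lemma open_dist_ball x r : open [set y | d x y < r].
Proof.
apply/open_distP => y /= xy; exists (r - d x y); first by lra.
by move=> z; have := dist_triangle y x z; lra.
Qed.

Lemma closed_dist_ball x r : closed [set y | d x y <= r].
Proof.
apply/closed_distP => y yr /=; rewrite leNgt; apply/negP => ry.
have [|z /= xz yz] := yr (d x y - r); first lra.
by have := dist_triangle z x y; rewrite (distC z y); lra.
Qed.

Lemma cvg_distP (u : nat -> X) x :
  u @ \oo --> x <->
  forall e, 0 < e -> exists N, forall n, (N <= n)%N -> d x (u n) < e.
Proof.
split=> [ux e e0|ux V /nbhs_distP[e e0 eV]].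
  have [|N _ NP] := ux [set y | d x y < e]; last by exists N.
  by apply/nbhs_distP; exists e.
by have [N NP] := ux _ e0; exists N => // n /NP /eV.
Qed.

(** The points whose open ball of radius [2 ^- n] stays in [A] form a closed set, and these sets
    exhaust [A]. *)
Lemma open_Fsigma A : open A -> Fsigma A.
Proof.
move=> Ao.
exists (fun n => [set x | forall y, d x y < 2 ^- n -> A y]); last first.
  apply/seteqP; split=> [x Ax|x [n _]]; last first.
    by apply; rewrite distxx invr_gt0 exprn_gt0.
  have [e e0 eA] := (open_distP A).1 Ao x Ax.
  have [n ne] := half_pow_lt e0; exists n => // y xy.
  by apply: eA; exact: lt_trans ne.
move=> n; apply/closed_distP => x xP y xy.
have [|z zP xz] := xP (2 ^- n - d x y); first lra.
by apply: zP; have := dist_triangle x z y; rewrite (distC z x); lra.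
Qed.

Lemma closed_set1_dist x : closed [set x].
Proof.
apply/closed_distP => y yx; apply: contrapT => /dist_gt0 /yx[z /= ->].
by rewrite distC ltxx.
Qed.

(** Otherwise nested balls centred in [K] can be chosen that avoid each [F n] in turn; by
    completeness their centres converge to a point of [K] outside every [F n]. Working relative to
    [K] and to a given ball avoids subspaces. *)
Lemma baire_closed_cover K (F : nat -> set X) x r :
  complete_metric d -> closed K -> (forall n, closed (F n)) ->
  K x -> 0 < r ->
  (forall y, K y -> d x y < r -> exists n, F n y) ->
  exists n y s, [/\ K y, 0 < s, forall z, d y z < s -> d x z < r &
    forall z, K z -> d y z < s -> F n z].
Proof.
move=> compl clK clF Kx r0 cover; apply: contrapT => noball.
pose good (p : X * R) := [/\ K p.1, 0 < p.2 &
  forall z, d p.1 z < p.2 -> d x z < r].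
pose shrunk n (p q : X * R) := [/\ good q, q.2 <= p.2 / 2,
  forall z, d q.1 z <= q.2 -> d p.1 z < p.2 &
  forall z, d q.1 z <= q.2 -> ~ F n z].
(* Shrinking is only possible from a good ball; with this condition under [exists], the choice
   function is total. *)
have step (np : nat * (X * R)) : exists q, good np.2 -> shrunk np.1 np.2 q.
  case: np => n [y s] /=; have [[/= Ky s0 ys]|bad] := pselect (good (y, s));
    last by exists (y, s).
  have [z [Kz yz nFz]] : exists z, [/\ K z, d y z < s & ~ F n z].
    apply: contrapT => noz; apply: noball; exists n, y, s; split=> // z Kz yz.
    by apply: contrapT => nFz; apply: noz; exists z.
  have : open (~` F n) by exact: closed_openC.
  move=> /open_distP /(_ z nFz) [e e0 eF].
  (* The three bounds make the closed ball around [z] miss [F n], halve the radius, and keep the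
     ball inside the previous one. *)
  pose t := Num.min (e / 2) (Num.min (s / 2) ((s - d y z) / 2)).
  have [te [ts tyz]] : t <= e / 2 /\ t <= s / 2 /\ t <= (s - d y z) / 2.
    by rewrite /t !ge_min !lexx ?orbT.
  have t0 : 0 < t by rewrite /t !lt_min; apply/and3P; split; lra.
  have sub w : d z w <= t -> d y w < s.
    by have := dist_triangle z y w; lra.
  exists (z, t) => _; split=> //=.
    by split=> // w /= zw; apply: ys; apply: sub; exact: ltW.
  by move=> w zw; apply: eF; lra.
have {}[next nextP] := choice step.
pose u := fix u n := if n is m.+1 then next (m, u m) else (x, r).
have ugood n : good (u n).
  by elim: n => [|n IH] //=; have [] := nextP (n, u n) IH.
have ushrunk n : shrunk n (u n) (u n.+1) by exact: (nextP (n, u n) (ugood n)).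
have unear n m : (n <= m)%N -> forall z, d (u m).1 z <= (u m).2 ->
    d (u n).1 z <= (u n).2.
  move=> /subnKC <-; elim: (m - n)%N => [|k IH] z; first by rewrite addn0.
  rewrite addnS => uz; apply: IH; apply: ltW.
  by have [_ _ + _] := ushrunk (n + k)%N; apply.
have ucenter n m : (n <= m)%N -> d (u n).1 (u m).1 <= (u n).2.
  by move=> nm; apply: (unear _ _ nm); rewrite distxx; have [_ /ltW] := ugood m.
have usmall n : (u n).2 <= r * 2 ^- n.
  elim: n => [|n IH]; first by rewrite expr0 invr1 mulr1.
  have [_ + _ _] := ushrunk n => /le_trans; apply.
  by rewrite exprS invfM; lra.
pose v n := (u n).1.
have [l ul] : exists l : X, v @ \oo --> l.
  apply: compl => e e0; have [|N Ne] := @half_pow_lt R (e / 2 / r).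
    by rewrite !divr_gt0.
  exists N => m n Nm Nn.
  have uN : (u N).2 < e / 2.
    by apply: le_lt_trans (usmall N) _; rewrite mulrC -ltr_pdivlMr.
  have := dist_triangle (u N).1 (u m).1 (u n).1.
  have := ucenter _ _ Nm; have := ucenter _ _ Nn; rewrite (distC (u m).1 (u N).1) /v.
  by lra.
have lin n : d (u n).1 l <= (u n).2.
  rewrite leNgt; apply/negP => nl.
  have [|N NP] := (cvg_distP _ _).1 ul (d (u n).1 l - (u n).2); first by lra.
  have := NP (maxn N n) (leq_maxl _ _); have := ucenter _ _ (leq_maxr N n).
  have := dist_triangle (u (maxn N n)).1 (u n).1 l.
  by rewrite /v (distC l); lra.
have Kl : K l.
  apply: (clK l); apply/closure_distP => e e0.
  have [N NP] := (cvg_distP _ _).1 ul _ e0.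
  by exists (u N).1; [have [] := ugood N|exact: NP].
have [n Fl] : exists n, F n l.
  by apply: cover => //; have [_ _ + _] := ushrunk 0%N; apply; exact: lin.
by have [_ _ _ /(_ _ (lin n.+1))] := ushrunk n.
Qed.

End metric_topology.

Arguments closed_dist_ball {R X d} dm dc x r.
Arguments closure_distP {R X d} dc A x.
Arguments dist_triangle {R X d} dm y x z.

Definition continuous_on {R : realType} {X Y : topologicalType}
    (d : X -> X -> R) (e : Y -> Y -> R) (A : set X) (f : X -> Y) :=
  forall x, A x -> forall r, 0 < r ->
    exists2 s, 0 < s & forall y, A y -> d x y < s -> e (f x) (f y) < r.

Section continuous_on_theory.
Context {R : realType} {X Y : topologicalType}.
Context (d : X -> X -> R) (e : Y -> Y -> R).
Hypotheses (dm : is_metric d) (dc : compatible d).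
Hypotheses (em : is_metric e) (ec : compatible e).

Lemma continuous_on_subset (A B : set X) (f : X -> Y) :
  A `<=` B -> continuous_on d e B f -> continuous_on d e A f.
Proof.
move=> AB fB x /AB Bx r r0; have [s s0 sP] := fB x Bx r r0.
by exists s => // y /AB; exact: sP.
Qed.

Lemma closed_preimage_on (A : set X) (B : set Y) (f : X -> Y) :
  closed A -> continuous_on d e A f -> closed B -> closed (A `&` f @^-1` B).
Proof.
move=> clA fA clB; apply/(closed_distP dc) => x xAB.
have Ax : A x.
  by move/(closed_distP dc) : clA; apply => r /xAB[y [Ay _]]; exists y.
split=> //=; move/(closed_distP ec) : clB; apply => r r0.
have [s s0 sP] := fA x Ax r r0; have [y [Ay By] xy] := xAB s s0.
by exists (f y) => //; exact: sP.
Qed.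

Lemma Fsigma_preimage_on (A : set X) (B : set Y) (f : X -> Y) :
  closed A -> continuous_on d e A f -> Fsigma B -> Fsigma (A `&` f @^-1` B).
Proof.
move=> clA fA [F clF ->]; rewrite preimage_bigcup setI_bigcupr.
apply: Fsigma_bigcup => n; apply: closed_Fsigma.
exact: closed_preimage_on.
Qed.

End continuous_on_theory.

(** * The Jayne-Rogers theorem for injective functions *)

Section nowhere_continuous.
Context {R : realType} {X Y : topologicalType}.
Context (d : X -> X -> R) (e : Y -> Y -> R).
Hypotheses (dm : is_metric d) (dc : compatible d) (dcompl : complete_metric d).
Hypotheses (em : is_metric e) (ec : compatible e).
Context (K : set X) (f : X -> Y).
Hypothesis clK : closed K.
Hypothesis finj : forall x y, K x -> K y -> f x = f y -> x = y.
Hypothesis fFsigma : forall B, Fsigma B -> Fsigma (K `&` f @^-1` B).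
Implicit Types (x y z w : X) (C : set Y) (r s : R).

Let cball (v : Y) r := [set y | e v y <= r].

Let avoids_on w s C := forall z, K z -> d w z < s -> ~ C (f z).

Let subball w s x r := forall z, d w z < s -> d x z < r.

(* The condition kept alive, for [C] a finite union of balls around the values
   chosen so far, so that new points can be added close to [x]. *)
Definition avoids_near x C := forall r, 0 < r ->
  exists w s, [/\ K w, 0 < s, subball w s x r & avoids_on w s C].

Let avoids_nearS x C C' : C `<=` C' -> avoids_near x C' -> avoids_near x C.
Proof.
move=> CC' xC' r /xC'[w [s [Kw s0 ws wC]]]; exists w, s; split=> //.
by move=> z Kz wz /CC'; exact: wC.
Qed.

(** Each point of [K] in the ball has its value outside [C1] or outside [C2], and both conditions
    define F_sigma sets. Interleaving their closed pieces by parity, Baire's theorem finds a ball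
    inside one piece. *)
Lemma baire_avoid C1 C2 x r : closed C1 -> closed C2 -> K x -> 0 < r ->
  avoids_on x r (C1 `&` C2) ->
  exists w s, [/\ K w, 0 < s, subball w s x r &
    avoids_on w s C1 \/ avoids_on w s C2].
Proof.
move=> cl1 cl2 Kx r0 xC12.
have FC C : closed C -> Fsigma (K `&` f @^-1` (~` C)).
  by move=> /closed_openC /(open_Fsigma em ec); exact: fFsigma.
have [F1 clF1 F1E] := FC _ cl1; have [F2 clF2 F2E] := FC _ cl2.
pose F n := if odd n then F1 n./2 else F2 n./2.
have [||n [w [s [Kw s0 ws wF]]]] := baire_closed_cover dm dc dcompl clK
    (_ : forall n, closed (F n)) Kx r0.
- by move=> n; rewrite /F; case: ifP.
- move=> y Ky xy; have [C1y|nC1y] := pselect (C1 (f y)).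
    have : (K `&` f @^-1` (~` C2)) y.
      by split=> // C2y; exact: (xC12 y Ky xy).
    by rewrite F2E => -[n _ Fy]; exists n.*2; rewrite /F odd_double doubleK.
  have : (K `&` f @^-1` (~` C1)) y by [].
  rewrite F1E => -[n _ Fy]; exists n.*2.+1.
  by rewrite /F /= odd_double /= uphalf_double.
exists w, s; split=> //; move: wF; rewrite /F; case: ifP => _ wF; [left|right].
  move=> z Kz wz; have : (\bigcup_n F1 n) z by exists n./2 => //; exact: wF.
  by rewrite -F1E => -[].
move=> z Kz wz; have : (\bigcup_n F2 n) z by exists n./2 => //; exact: wF.
by rewrite -F2E => -[].
Qed.

(* Two distinct values cannot both be limits of [f] at [x] along the points
   whose values avoid [C]. *)
Lemma avoids_nearU C x : avoids_near x C ->
  exists v0, forall v, v <> v0 ->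
    exists2 r, 0 < r & avoids_near x (C `|` cball v r).
Proof.
move=> xC; apply: contrapT => /forallNP bad.
have {}bad v0 : exists v, v <> v0 /\
    forall r, 0 < r -> ~ avoids_near x (C `|` cball v r).
  apply: contrapT => nov; apply: (bad v0) => v vv0; apply: contrapT => nr.
  by apply: nov; exists v; split=> // r r0 xr; apply: nr; exists r.
(* Here [f x] is an arbitrary starting value; what matters is that the bad values [v] and [v'] are
   distinct. *)
have [v [_ vbad]] := bad (f x); have [v' [v'v v'bad]] := bad v.
have evv' : 0 < e v v' by apply: (dist_gt0 em) => /esym.
(* A third of the distance makes the closed balls around [v] and [v'] disjoint, so [baire_avoid]
   lets [f] avoid one of them on a smaller ball. *)
pose r := e v v' / 3; have r0 : 0 < r by rewrite /r; lra.
apply: (vbad _ r0) => r1 r10; apply: contrapT => no1.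
apply: (v'bad _ r0) => r2 r20; apply: contrapT => no2.
have [|w [s [Kw s0 ws wC]]] := xC (Num.min r1 r2); first by rewrite lt_min r10.
have [|w' [s' [Kw' s'0 w's']]] := @baire_avoid (cball v r) (cball v' r) w s
    (closed_dist_ball em ec _ _) (closed_dist_ball em ec _ _) Kw s0.
  move=> z _ _ []; rewrite /cball /= => vz v'z; have := dist_triangle em (f z) v v'.
  by rewrite (distC em (f z) v'); move: vz v'z evv'; rewrite /r; lra.
have xw' z : d w' z < s' -> d x z < r1 /\ d x z < r2.
  by move=> /w's' /ws; rewrite lt_min => /andP.
case=> w'C; [apply: no1|apply: no2]; exists w', s'; split=> //.
- by move=> z /xw'[].
- by move=> z Kz w'z [Cz|]; [exact: wC (w's' _ w'z) Cz|exact: w'C].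
- by move=> z /xw'[].
- by move=> z Kz w'z [Cz|]; [exact: wC (w's' _ w'z) Cz|exact: w'C].
Qed.

Hypothesis nocont : forall x r, K x -> 0 < r ->
  ~ continuous_on d e [set y | K y /\ d x y < r] f.

(** Otherwise [f] would be continuous on the ball. If [y] and a nearby [z] had values at least [s]
    apart, the balls of radius [s / 4] around these values would be disjoint, so [f] would avoid one
    of them on a ball close to both [y] and [z]. *)
Lemma avoids_near_dense x r : K x -> 0 < r ->
  exists y s, [/\ K y, d x y < r, 0 < s & avoids_near y (cball (f y) s)].
Proof.
move=> Kx r0; apply: contrapT => none; apply: (nocont Kx r0).
have {}none y s : K y -> d x y < r -> 0 < s ->
    exists2 t, 0 < t & forall w u, K w -> 0 < u -> subball w u y t ->
      ~ avoids_on w u (cball (f y) s).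
  move=> Ky xy s0; apply: contrapT => nt; apply: none; exists y, s; split=> //.
  move=> t t0; apply: contrapT => nw; apply: nt; exists t => // w u Kw u0 wu wC.
  by apply: nw; exists w, u.
move=> y [Ky xy] s s0; have [//||t t0 tP] := none y (s / 4) Ky; first lra.
exists t => // z [Kz xz] yz; rewrite ltNge; apply/negP => syz.
have [//||t' t'0 t'P] := none z (s / 4) Kz; first lra.
have [||w [u [Kw u0 wu wC]]] := @baire_avoid
    (cball (f y) (s / 4)) (cball (f z) (s / 4)) z (Num.min t' (t - d y z))
    (closed_dist_ball em ec _ _) (closed_dist_ball em ec _ _) Kz.
- by rewrite lt_min t'0; lra.
- move=> v _ _ []; rewrite /cball /= => yv zv; have := dist_triangle em (f v) (f y) (f z).
  by rewrite (distC em (f v) (f z)); lra.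
have wz v : d w v < u -> d z v < t' /\ d y v < t.
  move=> /wu; rewrite lt_min => /andP[-> zv]; split=> //.
  by have := dist_triangle dm z y v; lra.
case: wC => wC; [apply: (tP _ _ Kw u0 _ wC)|apply: (t'P _ _ Kw u0 _ wC)].
  by move=> v /wz[].
by move=> v /wz[].
Qed.

(** By injectivity each value is taken at one point of [K] at most. This point is not isolated in
    [K], since [f] would be continuous near it, so the ball can be moved away from it. *)
Lemma avoids_values (V : seq Y) w s : K w -> 0 < s ->
  exists w' s', [/\ K w', 0 < s', subball w' s' w s &
    avoids_on w' s' [set` V]].
Proof.
move=> Kw s0; elim: V => [|v V [w' [s' [Kw' s'0 w's' w'V]]]].
  by exists w, s; split=> // z _ _.
have [[z [Kz w'z fzv]]|noz] :=
    pselect (exists z, [/\ K z, d w' z < s' & f z = v]); last first.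
  exists w', s'; split=> // z Kz w'z; rewrite /= inE => /orP[/eqP fzv|].
    by apply: noz; exists z.
  exact: w'V.
have [z' [Kz' w'z' z'z]] : exists z', [/\ K z', d w' z' < s' & z' <> z].
  apply: contrapT => noz'.
  have eqz y : K y -> d z y < s' - d w' z -> y = z.
    move=> Ky zy; apply: contrapT => yz; apply: noz'; exists y; split=> //.
    by have := dist_triangle dm z w' y; lra.
  apply: (nocont Kz (_ : 0 < s' - d w' z)); first by rewrite subr_gt0.
  move=> y [Ky zy] r r0; exists 1 => // y' [Ky' zy'] _.
  by rewrite (eqz _ Ky zy) (eqz _ Ky' zy') (distxx em).
have zz' := dist_gt0 dm z'z.
pose u := Num.min (d z' z) (s' - d w' z').
have [uz us] : u <= d z' z /\ u <= s' - d w' z'.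
  by rewrite /u !ge_min !lexx ?orbT.
have ballu y : d z' y < u -> d w' y < s'.
  by have := dist_triangle dm z' w' y; lra.
exists z', u; split=> //; first by rewrite lt_min zz' subr_gt0.
  by move=> y /ballu /w's'.
move=> y Ky z'y; rewrite /= inE => /orP[/eqP fyv|]; last exact: w'V (ballu _ _).
by have yz := finj Ky Kz (etrans fyv (esym fzv)); move: z'y; rewrite yz; lra.
Qed.

Let U (t : seq (X * R)) := [set y | exists2 p, p \in t & cball (f p.1) p.2 y].

(** The invariant of the construction: [t] lists the chosen points with radii around their values,
    and each of them can still be approached by balls on which [f] avoids all these value balls. *)
Let good (t : seq (X * R)) :=
  forall p, p \in t -> [/\ K p.1, 0 < p.2 & avoids_near p.1 (U t)].

Lemma common_radius (T : eqType) (t : seq T) (Q : T -> R -> Prop) :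
  (forall p r s, r <= s -> Q p s -> Q p r) ->
  (forall p, p \in t -> exists2 r, 0 < r & Q p r) ->
  exists2 r, 0 < r & forall p, p \in t -> Q p r.
Proof.
move=> Qmono; elim: t => [|p t IH] tQ; first by exists 1.
have [|r r0 rP] := IH; first by move=> q qt; apply: tQ; rewrite inE qt orbT.
have [|s s0 sP] := tQ p; first by rewrite mem_head.
exists (Num.min r s); first by rewrite lt_min r0.
move=> q; rewrite inE => /orP[/eqP ->|/rP].
  by apply: Qmono sP; rewrite ge_min lexx orbT.
by apply: Qmono; rewrite ge_min lexx.
Qed.

(** By [avoids_nearU] each listed point excludes only one centre for a further value ball. A ball
    near [p.1] on which [f] avoids [U t] is shrunk to miss these finitely many values, and the new
    point is taken there by [avoids_near_dense]. *)
Lemma good_extend t p r : good t -> p \in t -> 0 < r ->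
  exists q, [/\ good (q :: t), d p.1 q.1 < r & ~ U t (f q.1)].
Proof.
move=> gt pt r0; have [Kp p20 pU] := gt p pt.
have [w [s [Kw s0 ws wU]]] := pU r r0.
have badP (q : X * R) : exists v0, q \in t -> forall v, v <> v0 ->
    exists2 u, 0 < u & avoids_near q.1 (U t `|` cball v u).
  have [qt|qt] := boolP (q \in t); last by exists (f q.1).
  by have [_ _ /avoids_nearU[v0 v0P]] := gt q qt; exists v0.
have {badP}[bad badP] := choice badP.
have [w' [s' [Kw' s'0 w's' w'bad]]] := avoids_values (map bad t) Kw s0.
have [x [u [Kx w'x u0 xu]]] := avoids_near_dense Kw' s'0.
have xU : ~ U t (f x) by apply: wU => //; exact: w's'.
pose Q (q : X * R) v := avoids_near q.1 (U t `|` cball (f x) v).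
have [||v v0 vP] := @common_radius _ t Q.
- move=> q v v' vv'; apply: avoids_nearS => y [|/= yv]; [by left|right].
  exact: le_trans vv'.
- move=> q qt; apply: badP => // fxb; apply: (w'bad x Kx w'x) => /=.
  by rewrite fxb map_f.
(* The radius [u] suits the new point, and [v] suits all the old ones. *)
pose a := Num.min u v.
have [au av] : a <= u /\ a <= v by rewrite /a !ge_min !lexx ?orbT.
have a0 : 0 < a by rewrite lt_min u0.
have UE b : avoids_near b (U t `|` cball (f x) a) -> avoids_near b (U ((x, a) :: t)).
  apply: avoids_nearS => y [q]; rewrite inE => /orP[/eqP -> /= ay|qt qy].
    by right.
  by left; exists q.
exists (x, a); split=> //=; last exact: ws (w's' _ w'x).
move=> q; rewrite inE => /orP[/eqP ->|qt] /=; last first.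
  have [Kq q0 _] := gt q qt; split=> //; apply: UE.
  apply: avoids_nearS (vP q qt) => y [|/= ya]; [by left|right].
  exact: le_trans av.
split=> //; apply: UE => b b0.
have [|w1 [s1 [Kw1 s10 w1s1 w1x]]] := xu (Num.min b (s' - d w' x)).
  by rewrite lt_min b0 subr_gt0.
exists w1, s1; split=> // [z /w1s1|z Kz w1z]; rewrite ?lt_min; first by case/andP.
have := w1s1 z w1z; rewrite lt_min => /andP[_ xz].
have w'z : d w' z < s' by have := dist_triangle dm x w' z; lra.
case=> [|za]; first by apply: wU => //; exact: w's'.
by apply: (w1x z Kz w1z); exact: le_trans au.
Qed.


(** Stage [n] adds a point within [2 ^- n] of the point numbered [schedule n]. Every number recurs
    at arbitrarily late stages, so each point is a limit of later ones, while new values stay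
    outside the earlier value balls. *)
Lemma discrete_dense_in_itself_sequence : K !=set0 ->
  exists (x : nat -> X) (eps : nat -> R),
    [/\ forall n, K (x n), forall n, 0 < eps n,
        forall m n, (m < n)%N -> eps m < e (f (x m)) (f (x n)) &
        forall k r, 0 < r -> exists2 n, (k < n)%N & d (x k) (x n) < r].
Proof.
move=> [x0 Kx0].
have [x1 [e1 [Kx1 _ e10 x1e1]]] := avoids_near_dense Kx0 ltr01.
have step (a : seq (X * R) * (X * R) * nat) : exists q,
    good a.1.1 -> a.1.2 \in a.1.1 ->
    [/\ good (q :: a.1.1), d a.1.2.1 q.1 < 2 ^- a.2 & ~ U a.1.1 (f q.1)].
  case: a => -[t p] n /=; have [gt|] := pselect (good t); last by exists p.
  have [pt|] := boolP (p \in t); last by exists p.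
  have [|q qP] := good_extend gt pt (_ : 0 < 2 ^- n); last by exists q.
  by rewrite invr_gt0 exprn_gt0.
have {step}[next nextP] := choice step.
pose q0 := (x1, e1).
(* The list grows at its head, so the entry chosen at stage [k] is counted from the end. For [k] too
   large, truncated subtraction gives the head, which is still an entry. *)
pose prefix_head (t : seq (X * R)) k := nth q0 t (size t - k.+1).
pose S := fix S n := if n is m.+1
  then next (S m, prefix_head (S m) (schedule m), m) :: S m else [:: q0].
have sizeS n : size (S n) = n.+1 by elim: n => //= n ->.
have headS n k : prefix_head (S n) k \in S n.
  by apply: mem_nth; rewrite sizeS subSS ltnS leq_subr.
have gS n : good (S n).
  elim: n => [|n IH] /=; last first.
    by have [] := nextP (S n, prefix_head (S n) (schedule n), n) IH (headS _ _).
  move=> p; rewrite inE => /eqP ->; split=> //; apply: avoids_nearS x1e1.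
  by move=> y [q]; rewrite inE => /eqP ->.
pose q n := head q0 (S n).
have prefixS n k : (k <= n)%N -> prefix_head (S n) k = q k.
  move=> /subnK <-; elim: (n - k)%N => [|m IH].
    by rewrite /prefix_head sizeS subnn nth0.
  by rewrite -IH /prefix_head !sizeS !subSS addSn subSn ?leq_addl.
have qS n k : (k <= n)%N -> q k \in S n by move=> /prefixS <-.
have qP n := nextP (S n, prefix_head (S n) (schedule n), n) (gS n) (headS n _).
exists (fun n => (q n).1), (fun n => (q n).2); split=> [n|n|m [//|n]|k r r0].
- by have [] := gS n (q n) (qS _ _ (leqnn n)).
- by have [] := gS n (q n) (qS _ _ (leqnn n)).
- rewrite ltnS => /qS qmS; rewrite ltNge; apply/negP => le_e.
  by have [_ _] := qP n; apply; exists (q m).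
have [N NP] := half_pow_lt r0.
have [n [kn Nn nk]] := schedule_infinite k N.
have qk : prefix_head (S n) (schedule n) = q k by rewrite nk prefixS // ltnW.
exists n.+1; first exact: ltnW.
apply: (@lt_trans _ _ (2 ^- n)); first by rewrite -qk; have [] := qP n.
apply: le_lt_trans NP.
by apply: pow_half_le; exact: ltnW.
Qed.

(** A discrete set is open in its closure, so its complement is the union of a closed set and an
    open set. *)
Lemma Fsigma_setC_discrete (u : nat -> Y) (eps : nat -> R) :
  (forall n, 0 < eps n) ->
  (forall m n, (m < n)%N -> eps m < e (u m) (u n)) ->
  Fsigma (~` range u).
Proof.
move=> eps0 ueps.
(* Only finitely many values precede [u i], and the later ones are more than [eps i] away. *)
have isolated i : exists2 r, 0 < r & forall j, j != i -> r <= e (u i) (u j).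
  have [r r0 rP] : exists2 r, 0 < r & forall j, (j < i)%N -> r <= e (u i) (u j).
    have [||r r0 rP] := @common_radius _ (iota 0 i) (fun j s => s <= e (u i) (u j)).
    - by move=> j r s; exact: le_trans.
    - move=> j; rewrite mem_iota => /andP[_ ji]; exists (e (u i) (u j)) => //.
      by rewrite (distC em); apply: lt_trans (eps0 j) (ueps _ _ ji).
    by exists r => // j ji; apply: rP; rewrite mem_iota.
  exists (Num.min r (eps i)); first by rewrite lt_min r0 eps0.
  move=> j; case: ltngtP => // [/rP|/ueps] h _; rewrite ge_min ?h//.
  by rewrite (ltW h) orbT.
have /(_ _)/cid2-/all_sig2[r r0 rP] := isolated.
pose O := \bigcup_i [set y | e (u i) y < r i].
have OE : O `&` closure (range u) = range u.
  apply/seteqP; split=> [y [[i _ /= iy] /(closure_distP ec) cly]|_ [i _ <-]].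
    exists i => //; apply: contrapT => uiy; have y0 := dist_gt0 em uiy.
    have [|_ [j _ <-] yj] := cly (Num.min (e (u i) y) (r i - e (u i) y)).
      by rewrite lt_min y0 subr_gt0.
    move: yj; rewrite lt_min => /andP[yj1 yj2].
    have [ji|/(rP i)] := eqVneq j i; last by have := dist_triangle em y (u i) (u j); lra.
    by move: yj1; rewrite ji (distC em y) ltxx.
  split; last by apply: subset_closure; exists i.
  by exists i; rewrite //= (distxx em).
rewrite -OE setCI; apply: FsigmaU.
  apply: closed_Fsigma; apply: open_closedC; apply: bigcup_open => i _.
  exact: (open_dist_ball em ec).
apply: (open_Fsigma em ec); apply: closed_openC; exact: closed_closure.
Qed.

Lemma nowhere_continuous_set0 : K = set0.
Proof.
apply/eqP; apply: contrapT => /negP/set0P /discrete_dense_in_itself_sequence.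
move=> [x [eps [Kx eps0 xeps xdense]]].
have finjx m n : f (x m) = f (x n) -> m = n.
  have [/xeps + E|/xeps + E|//] := ltngtP m n; rewrite E (distxx em) => h.
    by have := lt_trans (eps0 _) h; rewrite ltxx.
  by have := lt_trans (eps0 _) h; rewrite ltxx.
have [F clF FE] := fFsigma (Fsigma_setC_discrete (u := f \o x) eps0 xeps).
(* The points of the sequence and the closed pieces of the remaining part of [K] cover the closure
   of the sequence. Every ball around a point of this closure contains two distinct points of the
   sequence, so it fits into no set of either kind. *)
pose H n := if odd n then F n./2 else [set x n./2].
have [||||n [y [s [cly s0 _ yH]]]] := @baire_closed_cover _ _ _ dm dc
   (closure (range x)) H (x 0%N) 1 dcompl (@closed_closure _ _).
- move=> n; rewrite /H; case: ifP => _ //; exact: (closed_set1_dist dm dc).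
- by apply: subset_closure; exists 0%N.
- exact: ltr01.
- move=> y cly _; have [[n _ xny]|xy] := pselect (range x y).
    by exists n.*2; rewrite /H odd_double doubleK.
  have Ky : K y by apply: clK; apply: closure_subset cly => _ [n _ <-].
  have : (K `&` f @^-1` (~` range (f \o x))) y.
    by split=> // -[n _ /= /finj xny]; apply: xy; exists n => //; exact: xny.
  rewrite FE => -[n _ Fy]; exists n.*2.+1.
  by rewrite /H /= odd_double /= uphalf_double.
have [_ [i _ <-] yi] := (closure_distP dc _ _).1 cly s s0.
have clx k : closure (range x) (x k) by apply: subset_closure; exists k.
have si : 0 < s - d y (x i) by rewrite subr_gt0.
have [m im xim] := xdense i _ si.
have ym : d y (x m) < s by have := dist_triangle dm (x i) y (x m); lra.
move: (yH _ (clx i) yi) (yH _ (clx m) ym); rewrite /H.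
case: ifP => _ => [Fi _|/= xiE xmE].
  have : (K `&` f @^-1` (~` range (f \o x))) (x i) by rewrite FE; exists n./2.
  by case=> _; apply; exists i.
have /finjx eqim : f (x i) = f (x m) by rewrite xiE xmE.
by move: im; rewrite eqim ltnn.
Qed.

End nowhere_continuous.

Section piecewise_continuous.
Context {R : realType} {X Y : topologicalType}.
Context (d : X -> X -> R) (e : Y -> Y -> R).

Definition piecewise_continuous_on (A : set X) (f : X -> Y) :=
  exists F : nat -> set X, [/\ forall n, closed (F n),
    forall n, continuous_on d e (F n) f & A `<=` \bigcup_n F n].

Lemma piecewise_continuous_bigcup (I : countType) (A : I -> set X) f :
  (forall i, piecewise_continuous_on (A i) f) ->
  piecewise_continuous_on (\bigcup_i A i) f.
Proof.
move=> /choice[F FP].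
exists (fun k => if unpickle k is Some (i, n) then F i n else set0).
split=> [k|k|x [i _ Aix]].
- by case: unpickle => [[i n]|]; [have [] := FP i|exact: closed0].
- by case: unpickle => [[i n]|]; [have [] := FP i|move=> ? []].
- have [_ _ /(_ x Aix)[n _ Fx]] := FP i.
  by exists (pickle (i, n)); rewrite // pickleK.
Qed.

Lemma piecewise_continuous_closed (A : set X) f :
  closed A -> continuous_on d e A f -> piecewise_continuous_on A f.
Proof. by move=> clA fA; exists (fun=> A); split=> // x Ax; exists 0%N. Qed.

Lemma piecewise_continuous_subset (A B : set X) f :
  A `<=` B -> piecewise_continuous_on B f -> piecewise_continuous_on A f.
Proof.
by move=> AB [F [clF fF BF]]; exists F; split=> //; exact: subset_trans BF.
Qed.

Hypotheses (dm : is_metric d) (dc : compatible d) (dcompl : complete_metric d).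
Hypotheses (em : is_metric e) (ec : compatible e).

(** All basic balls on which [f] is piecewise continuous are removed from [K]. On the remainder
    [K'], [f] is continuous on no nonempty relatively open part, so [K'] is empty and countably many
    such balls cover [K]. *)
Lemma jayne_rogers_inj (a : nat -> X) (K : set X) (f : X -> Y) :
  dense (range a) -> closed K ->
  (forall x y, K x -> K y -> f x = f y -> x = y) ->
  (forall B, Fsigma B -> Fsigma (K `&` f @^-1` B)) ->
  piecewise_continuous_on K f.
Proof.
move=> adense clK finj fF.
pose B (p : nat * nat) := [set x | d (a p.1) x < 2 ^- p.2].
have oB p : open (B p) by exact: (open_dist_ball dm dc).
pose G p := piecewise_continuous_on (K `&` B p) f.
pose A p := if `[< G p >] then K `&` B p else set0.
have pcA : piecewise_continuous_on (\bigcup_p A p) f.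
  apply: piecewise_continuous_bigcup => p; rewrite /A; case: asboolP => // _.
  by apply: piecewise_continuous_closed; [exact: closed0|move=> ? []].
have basis x r : 0 < r -> exists2 p, B p x & forall y, B p y -> d x y <= r.
  move=> r0; have [|n nr] := @half_pow_lt R (r / 2); first by rewrite divr_gt0.
  have [||y [/= xy [m _ amy]]] := adense [set y | d x y < 2 ^- n].
  - by exists x; rewrite /= (distxx dm) invr_gt0 exprn_gt0.
  - exact: (open_dist_ball dm dc).
  move: xy; rewrite -amy (distC dm) => xam.
  exists (m, n) => // z; rewrite /B /= => zam.
  by have := dist_triangle dm (a m) x z; rewrite (distC dm x (a m)); lra.
pose K' := K `&` ~` \bigcup_(p in G) B p.
have clK' : closed K'.
  apply: closedI => //; apply: open_closedC; apply: bigcup_open => p _.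
  exact: oB.
have K'0 : K' = set0.
  apply: (@nowhere_continuous_set0 _ _ _ d e dm dc dcompl em ec K' f) => //.
  - by move=> x y [Kx _] [Ky _]; exact: finj.
  - move=> C /fF FC; rewrite -(setIidl (_ : K' `<=` K)); last by move=> x [].
    by rewrite -setIA; apply: FsigmaI => //; exact: closed_Fsigma.
  move=> x r [Kx xG] r0 fcont; have [|p px pr] := basis x (r / 2).
    by rewrite divr_gt0.
  apply: xG; exists p => //; rewrite /G.
  (* The basic ball splits into the part covered by removed balls and the part in [K']; the latter
     lies in a closed ball on which [f] is continuous. So this ball should have been removed too. *)
  apply: (@piecewise_continuous_subset _
    (\bigcup_b (if b then \bigcup_q A q else K' `&` [set y | d x y <= r / 2]))).
    move=> y [Ky py]; have [[q Gq qy]|yG] := pselect ((\bigcup_(q in G) B q) y).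
      by exists true => //; exists q => //; rewrite /A; case: asboolP.
    by exists false => //; split; [split|exact: pr].
  apply: piecewise_continuous_bigcup => -[] //.
  apply: piecewise_continuous_closed.
    by apply: closedI => //; exact: (closed_dist_ball dm dc).
  apply: continuous_on_subset fcont => y [K'y /= xy]; split=> //.
  by apply: le_lt_trans xy _; lra.
apply: piecewise_continuous_subset pcA => x Kx; apply: contrapT => nAx.
suff : K' x by rewrite K'0.
split=> // -[p Gp px]; apply: nAx; exists p => //.
by rewrite /A; case: asboolP.
Qed.

End piecewise_continuous.

(** * Bijections from piecewise homeomorphisms *)

Section nat_product.
Context {X : topologicalType}.
Implicit Types (A : set (nat * X)).

Lemma nbhs_nat_prodP m (x : X) A :
  nbhs (m, x) A <-> nbhs x [set y | A (m, y)].
Proof.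
split=> [[[P Q] /= [Pm Qx] PQA]|xA].
  apply: filterS Qx => y Qy; apply: PQA; split=> //=; exact: nbhs_singleton.
exists ([set m], [set y | A (m, y)]); first by split; [exact: discrete_set1|].
by move=> [n y] /= [-> Ay].
Qed.

Lemma closed_nat_prodP A : closed A <-> forall m, closed [set x | A (m, x)].
Proof.
split=> [clA m x clx|clA [m x] clx].
  apply: clA => V /nbhs_nat_prodP /clx[y [Ay Vy]].
  by exists (m, y).
apply: clA => V xV; have [|[n y] [Ay /= [nm Vy]]] :=
    clx [set p | p.1 = m /\ V p.2].
  by apply/nbhs_nat_prodP; apply: filterS xV.
by exists y; split=> //; rewrite /= -nm.
Qed.

Lemma Fsigma_nat_prodP A : Fsigma A <-> forall m, Fsigma [set x | A (m, x)].
Proof.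
split=> [[F clF ->] m|/(_ _)/cid2-/all_sig2[F clF AE]].
  exists (fun n => [set x | F n (m, x)]) => [n|].
    exact: (closed_nat_prodP _).1 (clF n) m.
  by apply/seteqP; split=> x [n _ Fx]; exists n.
exists (fun n => [set p | F p.1 n p.2]) => [n|].
  by apply/closed_nat_prodP => m; exact: clF.
apply/seteqP; split=> [[m x] Ax|[m x] [n _ Fx]].
  by have : [set x | A (m, x)] x by []; rewrite AE => -[n _ Fx]; exists n.
have : (\bigcup_n F m n) x by exists n.
by rewrite -AE.
Qed.

End nat_product.

Section rank.
Implicit Types (p : nat -> bool) (c : nat).

(** The number of indices below [c] satisfying [p]: the position of [c] among them when [p c]
    holds. *)
Definition rank p c : nat := (\sum_(i < c) p i)%N.

Lemma rankS p c : rank p c.+1 = (rank p c + p c)%N.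
Proof. by rewrite /rank big_ord_recr. Qed.

Lemma rank_le p : {homo rank p : b c / (b <= c)%N}.
Proof.
apply: (homo_leq (r := fun i j => (i <= j)%N)) => [//|c b j|c].
  exact: leq_trans.
by rewrite rankS leq_addr.
Qed.

Lemma rank_inj p b c : p b -> p c -> rank p b = rank p c -> b = c.
Proof.
have lt_rank i j : p i -> (i < j)%N -> (rank p i < rank p j)%N.
  by move=> pi /(rank_le p); rewrite rankS pi addn1.
move=> pb pc rbc; have [bc|cb|//] := ltngtP b c.
  by have := lt_rank _ _ pb bc; rewrite rbc ltnn.
by have := lt_rank _ _ pc cb; rewrite rbc ltnn.
Qed.

(** The rank grows by at most one at each step, so the least [c] with [j < rank p c.+1] has rank
    exactly [j] and satisfies [p]. *)
Lemma rank_surj p j : (forall N, exists2 c, (N <= c)%N & p c) ->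
  exists2 c, p c & rank p c = j.
Proof.
move=> pinf; have ex_c : exists c, (j < rank p c.+1)%N.
  elim: j => [|j [c jc]].
    by have [c _ pc] := pinf 0%N; exists c; rewrite rankS pc addn1.
  have [b cb pb] := pinf c.+1; exists b; rewrite rankS pb addn1 ltnS.
  exact: leq_trans jc (rank_le p cb).
case: (ex_minnP ex_c) => c jc cmin.
have rank_c : (rank p c <= j)%N.
  case: c cmin {jc} => [_|c cmin]; first by rewrite /rank big_ord0.
  by rewrite leqNgt; apply/negP => /cmin; rewrite ltnn.
move: jc; rewrite rankS; case: (boolP (p c)) => pc.
  by rewrite addn1 ltnS => jc; exists c => //; apply/anti_leq/andP.
by rewrite addn0 ltnNge rank_c.
Qed.

End rank.

Section piecewise_bijection.
Context {X Y : Type} (A : nat -> set X) (B : nat -> set Y) (h : nat -> X -> Y).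

(** Reading the pieces along [schedule] repeats each one infinitely often, so that every [j] is the
    rank of some piece containing [z]. *)
Definition members (Z : Type) (C : nat -> set Z) z n := `[< C (schedule n) z >].

Definition select j x : nat :=
  xget 0%N [set c | members A x c /\ rank (members A x) c = j].

Definition piecewise_map (p : nat * X) : nat * Y :=
  let c := select p.1 p.2 in
  let y := h (schedule c) p.2 in (rank (members B y) c, y).

Hypothesis coverA : forall x, exists n, A n x.

Lemma selectP j x :
  members A x (select j x) /\ rank (members A x) (select j x) = j.
Proof.
suff : [set c | members A x c /\ rank (members A x) c = j] (select j x) by [].
apply: xgetPex; have [|c Ac cj] := @rank_surj (members A x) j; last by exists c.
move=> N; have [n An] := coverA x; have [c [_ Nc cn]] := schedule_infinite n N.
by exists c; [exact: ltnW|apply/asboolP; rewrite cn].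
Qed.

Lemma select_eq j x c :
  members A x c -> rank (members A x) c = j -> select j x = c.
Proof.
by move=> Ac cj; have [As sj] := selectP j x; apply: rank_inj As Ac _; rewrite sj.
Qed.

End piecewise_bijection.

Section piecewise_bijection_cancel.
Context {X Y : Type} (A : nat -> set X) (B : nat -> set Y).
Context (h : nat -> X -> Y) (k : nat -> Y -> X).
Hypothesis coverA : forall x, exists n, A n x.
Hypothesis coverB : forall y, exists n, B n y.
Hypothesis AB : forall n x, A n x -> B n (h n x) /\ k n (h n x) = x.

(** Both maps use the same index [c]: it is determined by its rank among the pieces containing the
    image point, and there [k] undoes [h]. *)
Lemma piecewise_mapK : cancel (piecewise_map A B h) (piecewise_map B A k).
Proof.
move=> [j x]; rewrite /piecewise_map /=.
have [/asboolP Ac cj] := selectP coverA j x; set c := select A j x in Ac cj *.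
have [Bc kc] := AB Ac.
by rewrite (select_eq coverB (_ : members B _ c) erefl) ?kc ?cj//; apply/asboolP.
Qed.

End piecewise_bijection_cancel.

Section piecewise_bijection_Borel.
Context {R : realType} {X Y : topologicalType}.
Context (d : X -> X -> R) (e : Y -> Y -> R).
Hypotheses (dm : is_metric d) (dc : compatible d).
Hypotheses (em : is_metric e) (ec : compatible e).

(** The rank depends on membership in finitely many closed sets, and both these sets and their
    complements are F_sigma. *)
Lemma Fsigma_rank_members (C : nat -> set X) c j : (forall n, closed (C n)) ->
  Fsigma [set x | rank (members C x) c = j].
Proof.
move=> clC; elim: c j => [|c IH] j.
  have -> : [set x | rank (members C x) 0 = j] = [set x | 0%N = j].
    by apply/seteqP; split=> x; rewrite /= /rank big_ord0.
  have [<-|j0] := pselect (0%N = j); apply: closed_Fsigma.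
    by rewrite (_ : mkset _ = setT); [exact: closedT|apply/seteqP].
  by rewrite (_ : mkset _ = set0); [exact: closed0|apply/seteqP; split].
have -> : [set x | rank (members C x) c.+1 = j] =
    (C (schedule c) `&` [set x | (rank (members C x) c).+1 = j]) `|`
    (~` C (schedule c) `&` [set x | rank (members C x) c = j]).
  apply/seteqP; split=> x; rewrite /= rankS /members.
    by case: asboolP => Cx /=; rewrite ?addn1 ?addn0; [left|right].
  by case=> -[Cx xj]; case: asboolP => //= _; rewrite ?addn1 ?addn0.
apply: FsigmaU; apply: FsigmaI; last exact: IH.
- exact: closed_Fsigma.
- case: j => [|j].
    by apply: closed_Fsigma; rewrite (_ : mkset _ = set0);
      [exact: closed0|apply/seteqP; split].
  have -> : [set x | (rank (members C x) c).+1 = j.+1] =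
      [set x | rank (members C x) c = j]; last exact: IH.
  by apply/seteqP; split=> x /= [->].
- by apply: (open_Fsigma dm dc); exact: closed_openC.
Qed.

Variables (A : nat -> set X) (B : nat -> set Y) (h : nat -> X -> Y).
Hypotheses (clA : forall n, closed (A n)).
Hypotheses (hA : forall n, continuous_on d e (A n) (h n)).
Hypothesis coverA : forall x, exists n, A n x.
Hypothesis FB : forall c j, Fsigma [set y | rank (members B y) c = j].

(** Fixing the selected index [c] and the output rank [l] splits the preimage into countably many
    parts, on each of which the second component is a single map continuous on a closed piece. *)
Lemma piecewise_map_first_level : first_level_Borel (piecewise_map A B h).
Proof.
move=> C /Fsigma_nat_prodP FC; apply/Fsigma_nat_prodP => j.
pose V c l := [set y | rank (members B y) c = l] `&` [set y | C (l, y)].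
have -> : [set x | (piecewise_map A B h @^-1` C) (j, x)] =
  \bigcup_(cl : nat * nat) ([set x | rank (members A x) cl.1 = j] `&`
   (A (schedule cl.1) `&` h (schedule cl.1) @^-1` V cl.1 cl.2)); last first.
  apply: Fsigma_bigcup => -[c l] /=; apply: FsigmaI.
    exact: Fsigma_rank_members.
  by apply: (Fsigma_preimage_on dc ec) => //; apply: FsigmaI.
apply/seteqP; split=> [x Cx|x [[c l] _ /= [xj [Ax [yl Cy]]]]].
  have [/asboolP Ac cj] := selectP coverA j x.
  by exists (select A j x, (piecewise_map A B h (j, x)).1).
rewrite /= /piecewise_map /= (select_eq coverA (_ : members A _ c) xj); last first.
  exact/asboolP.
by rewrite yl.
Qed.

End piecewise_bijection_Borel.

(** * Oracle computations *)

Scheme eval_mut_ind := Minimality for eval Sort Prop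
  with evals_mut_ind := Minimality for evals Sort Prop.

(** The use principle: a terminating computation asks the oracle finitely many questions, all below
    some [N]. *)
Lemma eval_use O c v r : eval O c v r ->
  exists N, forall O', (forall n, (n < N)%N -> O n = O' n) -> eval O' c v r.
Proof.
move: c v r; apply: (@eval_mut_ind O
  (fun c v r => exists N, forall O', (forall n, (n < N)%N -> O n = O' n) ->
     eval O' c v r)
  (fun gs v w => exists N, forall O', (forall n, (n < N)%N -> O n = O' n) ->
     evals O' gs v w)).
- by move=> v; exists 0%N => O' _; exact: eval_Zero.
- by move=> n v; exists 0%N => O' _; exact: eval_Succ.
- by move=> i v iv; exists 0%N => O' _; exact: eval_Proj.
- by move=> n v; exists n.+1 => O' /(_ n (ltnSn n)) ->; exact: eval_Oracle.
- move=> f gs v w r _ [N NP] _ [M MP]; exists (maxn N M) => O' OO'.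
  apply: eval_Comp (NP _ _) (MP _ _) => n nlt; apply: OO';
    by rewrite leq_max nlt ?orbT.
- by move=> f g v r _ [N NP]; exists N => O' OO'; apply: eval_PrimRec0; exact: NP.
- move=> f g n v s r _ [N NP] _ [M MP]; exists (maxn N M) => O' OO'.
  apply: eval_PrimRecS (NP _ _) (MP _ _) => m mlt; apply: OO';
    by rewrite leq_max mlt ?orbT.
- move=> f v n k _ kP _ [N NP].
  have {}kP (m : 'I_n) : exists N, forall O', (forall n, (n < N)%N -> O n = O' n) ->
      eval O' f (val m :: v) (k m).+1 by exact: kP (ltn_ord m).
  have {kP}[M MP] := choice kP.
  exists (maxn N (\max_m M m)) => O' OO'; apply: (eval_Mu (k := k)).
    move=> m mn; apply: (MP (Ordinal mn)) => i iM; apply: OO'.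
    rewrite leq_max; apply/orP; right; apply: leq_trans iM _.
    exact: (leq_bigmax (Ordinal mn)).
  by apply: NP => i iN; apply: OO'; rewrite leq_max iN.
- by move=> v; exists 0%N => O' _; exact: evals_nil.
- move=> g gs v x w _ [N NP] _ [M MP]; exists (maxn N M) => O' OO'.
  apply: evals_cons (NP _ _) (MP _ _) => m mlt; apply: OO';
    by rewrite leq_max mlt ?orbT.
Qed.

Lemma eval_inj O c v r r' : eval O c v r -> eval O c v r' -> r = r'.
Proof.
move=> er; move: c v r er r'; apply: (@eval_mut_ind O
  (fun c v r => forall r', eval O c v r' -> r = r')
  (fun gs v w => forall w', evals O gs v w' -> w = w')).
- by move=> v r' H; inversion H.
- by move=> n v r' H; inversion H.
- by move=> i v iv r' H; inversion H.
- by move=> n v r' H; inversion H.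
- move=> f gs v w r _ IHw _ IHr r' H; inversion H; subst.
  by match goal with ew : evals _ gs _ ?w', er : eval _ f _ r' |- _ =>
    apply: IHr; rewrite (IHw _ ew) end.
- by move=> f g v r _ IH r' H; inversion H; subst; exact: IH.
- move=> f g n v s r _ IHs _ IHr r' H; inversion H; subst.
  by match goal with es : eval _ (PrimRec f g) (n :: v) _ |- _ =>
    apply: IHr; rewrite (IHs _ es) end.
- move=> f v n k _ IHk _ IH0 r' H; inversion H; subst.
  have [nr'|r'n|//] := ltngtP n r'.
    by match goal with ek : forall m, is_true (m < r')%N -> _ |- _ =>
      have := IH0 _ (ek _ nr') end.
  by match goal with e0 : eval _ f (r' :: v) 0%N |- _ =>
    have := IHk _ r'n _ e0 end.
- by move=> v w' H; inversion H.
- move=> g gs v x w _ IHx _ IHw w' H; inversion H; subst.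
  by match goal with ex : eval _ g v _, ew : evals _ gs v _ |- _ =>
    rewrite (IHx _ ex) (IHw _ ew) end.
Qed.

(** An injection into a countable type, showing that there are countably many programs. *)
Fixpoint tree_of_code (c : code) : GenTree.tree nat :=
  match c with
  | Zero => GenTree.Node 0 [::]
  | Succ => GenTree.Node 1 [::]
  | Proj i => GenTree.Leaf i
  | Oracle => GenTree.Node 2 [::]
  | Comp f gs => GenTree.Node 3 (tree_of_code f :: map tree_of_code gs)
  | PrimRec f g => GenTree.Node 4 [:: tree_of_code f; tree_of_code g]
  | Mu f => GenTree.Node 5 [:: tree_of_code f]
  end.

Fixpoint code_of_tree (t : GenTree.tree nat) : code :=
  match t with
  | GenTree.Leaf i => Proj i
  | GenTree.Node 1 _ => Succ
  | GenTree.Node 2 _ => Oracle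
  | GenTree.Node 3 (t :: ts) => Comp (code_of_tree t) (map code_of_tree ts)
  | GenTree.Node 4 [:: t; t'] => PrimRec (code_of_tree t) (code_of_tree t')
  | GenTree.Node 5 [:: t] => Mu (code_of_tree t)
  | _ => Zero
  end.

Lemma tree_of_codeK : cancel tree_of_code code_of_tree.
Proof.
(* The arguments of [Comp] form a list of codes, so the nested structural recursion is written out
   by [fix]. *)
rewrite /cancel; fix IH 1; case=> [||i||f gs|f g|f] //=; rewrite ?IH//; congr (Comp _ _).
by elim: gs => //= g gs ->; rewrite IH.
Qed.

Lemma code_enumeration : exists E : nat -> code, forall c, exists n, E n = c.
Proof.
exists (fun n => if unpickle n is Some t then code_of_tree t else Zero) => c.
by exists (pickle (tree_of_code c)); rewrite pickleK tree_of_codeK.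
Qed.

Section names.
Context {R : realType} {X : topologicalType} (P : presentation R X).
Hypotheses (dm : is_metric (dist P)) (dc : compatible (dist P)).

Lemma name_le p x n : is_name P p x -> dist P (pt P (p n)) x <= 2 ^- n.
Proof.
move=> [pd /(cvg_distP dc) px]; rewrite leNgt; apply/negP => nx.
have [|N NP] := px (dist P (pt P (p n)) x - 2 ^- n); first by rewrite subr_gt0.
have := NP (maxn N n) (leq_maxl _ _); have := pd n (maxn N n) (leq_maxr _ _).
have := dist_triangle dm (pt P (p (maxn N n))) (pt P (p n)) x.
by rewrite /= (distC dm x); lra.
Qed.

Lemma is_name_approx p x :
  (forall n, dist P (pt P (p n)) x < 2 ^- n.+1) -> is_name P p x.
Proof.
move=> px; split=> [n m nm|].
  have := dist_triangle dm x (pt P (p n)) (pt P (p m)).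
  have := px n; have := px m; rewrite (distC dm (pt P (p m))).
  by have := @pow_half_le R n.+1 m.+1 nm; rewrite (pow_halfS n); lra.
apply/(cvg_distP dc) => e e0; have [N Ne] := half_pow_lt e0.
exists N => n Nn; rewrite (distC dm); apply: lt_trans (px n) _.
by apply: le_lt_trans Ne; apply: pow_half_le; exact: ltnW.
Qed.

Hypothesis dd : dense (range (pt P)).

Lemma dense_approx x r : 0 < r -> exists a, dist P (pt P a) x < r.
Proof.
move=> r0; have [||y [/= xa [a _ aE]]] := @dd [set y | dist P x y < r].
- by exists x; rewrite /= (distxx dm).
- exact: (open_dist_ball dm dc).
by exists a; rewrite (distC dm) aE.
Qed.

Lemma approx_exists (k : nat) x :
  exists p, forall n, dist P (pt P (p n)) x < 2 ^- (n + k)%N.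
Proof.
have approx n : exists a, dist P (pt P a) x < 2 ^- (n + k)%N.
  by apply: dense_approx; exact: pow_half_gt0.
by have [p pP] := choice approx; exists p.
Qed.

End names.

(** * Truth-table reductions as a countable family of continuous maps with closed domains *)

Section computable_functions.
Context {R : realType} {X Y : topologicalType} (alpha : nat -> bool).
Context (P : presentation R X) (Q : presentation R Y).
Hypotheses (dm : is_metric (dist P)) (dc : compatible (dist P)).
Hypothesis (dd : dense (range (pt P))).
Hypotheses (em : is_metric (dist Q)) (ec : compatible (dist Q)).

(** An entry of the output depends on finitely many entries of the name. A point close to [x] has a
    name sharing these entries, so both values have the same approximation. *)
Lemma computable_on_continuous D f :
  computable_on alpha P Q D f -> continuous_on (dist P) (dist Q) D f.
Proof.
move=> [c cP] x Dx r r0.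
(* The name is twice as precise as [is_name_approx] asks, which leaves room for replacing [x] by a
   nearby [y]. *)
have [p px] := approx_exists dm dc dd 2 x.
have [|q cq qn] := cP x Dx p.
  apply: (is_name_approx dm dc) => n; apply: lt_le_trans (px n) _.
  by apply: pow_half_le; rewrite addn2.
have [|n nr] := @half_pow_lt R (r / 2); first by rewrite divr_gt0.
have [N use] := eval_use (cq n).
exists (2 ^- N.+2); first exact: pow_half_gt0.
move=> y Dy xy; have [py pyP] := approx_exists dm dc dd 1 y.
pose p' i := if (i < N)%N then p i else py i.
have [|q' cq' qn'] := cP y Dy p'.
  apply: (is_name_approx dm dc) => i; rewrite /p'; case: ltnP => iN.
    have := dist_triangle dm x (pt P (p i)) y; have := px i.
    rewrite (pow_halfS i.+1) addn2.
    by have := @pow_half_le R i.+2 N.+2; rewrite ltnW// => /(_ isT); lra.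
  by have := pyP i; rewrite addn1.
(* An odd query [i < N] reads the name at [i./2], again below [N], where [p] and [p'] agree. *)
have qE : q' n = q n.
  apply: eval_inj (cq' n) _; apply: use => i iN; rewrite /join_oracle /p'.
  case: ifP => // _; case: ltnP => //; rewrite leqNgt; case/negP.
  by apply: leq_ltn_trans iN; rewrite -{2}[i]odd_double_half -addnn addnA leq_addl.
have := dist_triangle em (pt Q (q n)) (f x) (f y).
have := name_le em ec n qn; have := name_le em ec n qn'.
by rewrite qE (distC em (f x) (pt _ _)); lra.
Qed.

Lemma Pi01_closed D : Pi01 alpha P D -> closed D.
Proof.
move=> [ctr [num [den [_ _ _ ->]]]]; apply: open_closedC; apply: bigcup_open => k _.
exact: (open_dist_ball dm dc).
Qed.

(** Four programs determine a reduction: three list the balls complementary to its domain and one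
    computes its values. Indices coding no reduction get the empty domain and the constant value
    [y0]. *)
Lemma tt_le_family (y0 : Y) : exists (A : nat -> set X) (h : nat -> X -> Y),
  [/\ forall i, closed (A i),
      forall i, continuous_on (dist P) (dist Q) (A i) (h i) &
      forall x y, tt_le alpha Q y P x -> exists2 i, A i x & h i x = y].
Proof.
have [E EP] := code_enumeration.
pose computes c (u : nat -> nat) :=
  forall n, eval (cantor_oracle alpha) c [:: n] (u n).
have computes_inj c u u' : computes c u -> computes c u' -> u = u'.
  by move=> cu cu'; apply/funext => n; exact: eval_inj (cu n) (cu' n).
(* The codes determine the domain, and the function on this domain (but not
   elsewhere, so that a representative has to be chosen). *)
pose coded (t : code * code * code * code) (Df : set X * (X -> Y)) :=
  let: (c1, c2, c3, c) := t in exists center num den,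
  [/\ computes c1 center, computes c2 num, computes c3 den,
      Df.1 = ~` \bigcup_k [set x | dist P (pt P (center k)) x
                                    < (num k)%:R / (den k).+1%:R] &
      forall x, Df.1 x -> forall p, is_name P p x ->
        exists2 q, Phi alpha c p q & is_name Q q (Df.2 x)].
pose ok (Df : set X * (X -> Y)) :=
  closed Df.1 /\ continuous_on (dist P) (dist Q) Df.1 Df.2.
have coded_ok t Df : coded t Df -> ok Df.
  case: t => -[[c1 c2] c3] c [ctr [num [den [h1 h2 h3 DE cf]]]]; split.
    by apply: Pi01_closed; exists ctr, num, den; split=> //;
      [exists c1|exists c2|exists c3].
  by apply: computable_on_continuous; exists c.
have coded_inj t Df Df' x :
    coded t Df -> coded t Df' -> Df.1 x -> Df'.1 x /\ Df'.2 x = Df.2 x.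
  case: t => -[[c1 c2] c3] c [a [u [v [a1 u2 v3 DE cf]]]].
  move=> [a' [u' [v' [a1' u2' v3' DE' cf']]]] Dx.
  have Dx' : Df'.1 x.
    move: Dx; rewrite DE DE' (computes_inj _ _ _ a1' a1).
    by rewrite (computes_inj _ _ _ u2' u2) (computes_inj _ _ _ v3' v3).
  split=> //; have [p px] := approx_exists dm dc dd 1 x.
  have pn : is_name P p x.
    by apply: (is_name_approx dm dc) => n; have := px n; rewrite addn1.
  have [q cq qx] := cf x Dx p pn; have [q' cq' qx'] := cf' x Dx' p pn.
  (* The common output of the program approximates both values to within every [2 ^- n], so they
     cannot differ. *)
  apply: contrapT => /(dist_gt0 em) h0.
  have [|n nh] := @half_pow_lt R (dist Q (Df'.2 x) (Df.2 x) / 2).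
    by rewrite divr_gt0.
  have := name_le em ec n qx; have := name_le em ec n qx'.
  rewrite (eval_inj (cq' n) (cq n)).
  have := dist_triangle em (pt Q (q n)) (Df'.2 x) (Df.2 x).
  by rewrite (distC em (Df'.2 x) (pt _ _)); lra.
have total t : exists Df, ok Df /\ ((exists Df', coded t Df') -> coded t Df).
  have [[Df Dft]|no] := pselect (exists Df, coded t Df).
    by exists Df; split=> //; exact: coded_ok Dft.
  exists (set0, fun=> y0); split; last by [].
  by split; [exact: closed0|move=> ? []].
have {total}[Df DfP] := choice total.
pose index k := if @unpickle (nat * nat * nat * nat)%type k is Some (a, b, c, d)
  then (E a, E b, E c, E d) else (Zero, Zero, Zero, Zero).
exists (fun k => (Df (index k)).1), (fun k => (Df (index k)).2); split.
- by move=> k; have [[]] := DfP (index k).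
- by move=> k; have [[]] := DfP (index k).
move=> x y [D [f [[ctr [num [den [[c1 h1] [c2 h2] [c3 h3] DE]]]] [c cf] Dx fx]]].
have [[n1 E1] [n2 E2] [n3 E3] [n4 E4]] := And4 (EP c1) (EP c2) (EP c3) (EP c).
have iE : index (pickle (n1, n2, n3, n4)) = (c1, c2, c3, c).
  by rewrite /index pickleK E1 E2 E3 E4.
have cDf : coded (c1, c2, c3, c) (D, f) by exists ctr, num, den.
have [_ /(_ (ex_intro _ _ cDf)) cDf'] := DfP (c1, c2, c3, c).
have [Dx' fx'] := coded_inj _ _ _ _ cDf cDf' Dx.
by exists (pickle (n1, n2, n3, n4)); rewrite iE // fx'.
Qed.

End computable_functions.

(** * Programs that recover functions from their graphs stored in the oracle *)

Section programs.
Context (O : nat -> nat).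

Lemma eval_comp1 f g v x r :
  eval O g v x -> eval O f [:: x] r -> eval O (Comp f [:: g]) v r.
Proof. by move=> gx; apply: eval_Comp; apply: evals_cons gx (evals_nil _ _). Qed.

Fixpoint const_code n := if n is m.+1 then Comp Succ [:: const_code m] else Zero.

Lemma eval_const n v : eval O (const_code n) v n.
Proof.
by elim: n => [|n IH]; [exact: eval_Zero|exact: eval_comp1 IH (eval_Succ _ _ _)].
Qed.

Definition double_code := PrimRec Zero (Comp Succ [:: Comp Succ [:: Proj 1]]).

Lemma eval_double n : eval O double_code [:: n] n.*2.
Proof.
elim: n => [|n IH]; first by apply: eval_PrimRec0; exact: eval_Zero.
apply: eval_PrimRecS IH _; rewrite doubleS.
apply: eval_comp1 (eval_Succ _ _ _); apply: eval_comp1 (eval_Succ _ _ _).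
exact: (@eval_Proj _ 1 [:: n; n.*2]).
Qed.

(** Computes the pairing that [CodeSeq.code] iterates. *)
Definition pair_code :=
  PrimRec (Comp Succ [:: double_code]) (Comp double_code [:: Proj 1]).

Lemma eval_pair a b : eval O pair_code [:: a; b] (2 ^ a * b.*2.+1)%N.
Proof.
elim: a => [|a IH]; rewrite ?expn0 ?mul1n.
  by apply: eval_PrimRec0; apply: eval_comp1 (eval_double _) (eval_Succ _ _ _).
apply: eval_PrimRecS IH _; rewrite expnS -mulnA mul2n.
apply: eval_comp1 (eval_double _).
exact: (@eval_Proj _ 1 [:: a; (2 ^ a * b.*2.+1)%N; b]).
Qed.

Definition seq_code gs := foldr (fun g c => Comp pair_code [:: g; c]) Zero gs.

Lemma eval_seq gs v w : evals O gs v w -> eval O (seq_code gs) v (CodeSeq.code w).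
Proof.
elim: gs w => [|g gs IH] w ew; inversion ew; subst; first exact: eval_Zero.
apply: eval_Comp (eval_pair _ _); apply: evals_cons => //.
by apply: evals_cons (evals_nil _ _); exact: IH.
Qed.

Definition not_code := PrimRec (const_code 1) Zero.

Lemma eval_not n : eval O not_code [:: n] (n == 0%N).
Proof.
elim: n => [|n IH]; first by apply: eval_PrimRec0; exact: eval_const.
by apply: eval_PrimRecS IH _; exact: eval_Zero.
Qed.

Definition pred_code := PrimRec Zero (Proj 0).

Lemma eval_pred n : eval O pred_code [:: n] n.-1.
Proof.
elim: n => [|n IH]; first by apply: eval_PrimRec0; exact: eval_Zero.
by apply: eval_PrimRecS IH _; exact: (@eval_Proj _ 0 [:: n; n.-1]).
Qed.

(** [Mu] stops at a zero; after negation the search stops at the first nonzero value. *)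
Definition search_code c := Mu (Comp not_code [:: c]).

Lemma eval_search c v (u : nat -> nat) n :
  (forall m, eval O c (m :: v) (u m)) -> u n != 0%N ->
  (forall m, (m < n)%N -> u m = 0%N) -> eval O (search_code c) v n.
Proof.
move=> cu un um; apply: (eval_Mu (k := fun=> 0%N)).
  by move=> m /um um0; apply: eval_comp1 (cu m) _; rewrite um0; exact: eval_not.
by apply: eval_comp1 (cu n) _; rewrite -[X in eval _ _ _ X]/(nat_of_bool false)
  -(negbTE un); exact: eval_not.
Qed.

Lemma evals_proj m n v : (m + n = size v)%N ->
  evals O [seq Proj i | i <- iota m n] v (drop m v).
Proof.
elim: n m => [|n IH] m mn /=.
  by rewrite drop_oversize -?mn ?addn0//; exact: evals_nil.
have mv : (m < size v)%N by rewrite -mn addnS ltnS leq_addr.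
rewrite (drop_nth 0%N mv); apply: evals_cons; first exact: eval_Proj.
by apply: IH; rewrite addSnnS.
Qed.

(* [qc] is a program for the bit oracle [alpha]: the oracle itself, or its even
   part in the case of a join. *)
Context (alpha : nat -> bool) (qc : code).
Hypothesis eval_qc : forall n, eval O qc [:: n] (alpha n).

(** The bits with tag [t] decide the graph of [F], so one oracle holds countably many functions,
    each recovered by searching for [y]. *)
Definition encodes t (F : seq nat -> nat) :=
  forall y v, alpha (CodeSeq.code [:: t, y & v]) = (y == F v).

Definition lookup_code t n := search_code
  (Comp qc [:: seq_code (const_code t :: [seq Proj i | i <- iota 0 n.+1])]).

Lemma eval_lookup t F v : encodes t F -> eval O (lookup_code t (size v)) v (F v).
Proof.
move=> tF; apply: (@eval_search _ _ (fun y => y == F v)) => [y| |y yF].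
- rewrite -tF; apply: eval_comp1 (eval_qc _); apply: eval_seq.
  by apply: evals_cons (eval_const _ _) _; exact: (@evals_proj 0 _ (y :: v)).
- by rewrite eqxx.
- by rewrite ltn_eqF.
Qed.

End programs.

Lemma encodes_exists (I : countType) (F : I -> seq nat -> nat) :
  exists alpha, forall i, exists t, encodes alpha t (F i).
Proof.
exists (fun n => if CodeSeq.decode n is [:: t, y & v]
  then if unpickle t is Some i then y == F i v else false else false) => i.
by exists (pickle i) => y v; rewrite CodeSeq.codeK pickleK.
Qed.

Section oracle_computability.
Context (alpha : nat -> bool).

Definition lookup_computable F := exists t, encodes alpha t F.

Lemma eval_Oracle_bit n : eval (cantor_oracle alpha) Oracle [:: n] (alpha n).
Proof. exact: eval_Oracle. Qed.

Lemma lookup_computable1 F : lookup_computable F ->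
  computable1 alpha (fun n => F [:: n]).
Proof.
move=> [t tF]; exists (lookup_code Oracle t 1) => n.
exact: (eval_lookup eval_Oracle_bit [:: n] tF).
Qed.

Lemma lookup_computable3 F : lookup_computable F ->
  computable3 alpha (fun l m n => F [:: l; m; n]).
Proof.
move=> [t tF]; exists (lookup_code Oracle t 3) => l m n.
exact: (eval_lookup eval_Oracle_bit [:: l; m; n] tF).
Qed.

(* The functional sends [p] to [n |-> T(n, k, p k) - 1], for the least [k] with
   [T(n, k, p k) <> 0]. *)
Lemma lookup_Phi T : lookup_computable T ->
  exists c, forall p, (forall n, exists k, T [:: n; k; p k] != 0%N) ->
    exists2 q, Phi alpha c p q &
      forall n, exists k, T [:: n; k; p k] = (q n).+1.
Proof.
(* In the join, [qc] reads [alpha] at even queries and [pc] reads the name at odd ones. *)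
move=> [t tT]; pose qc := Comp Oracle [:: double_code].
pose pc := Comp Oracle [:: Comp Succ [:: double_code]].
(* The search variable [k] comes first in the argument list, hence the exchanged projections. *)
pose Tk := Comp (lookup_code qc t 3) [:: Proj 1; Proj 0; Comp pc [:: Proj 0]].
exists (Comp pred_code [:: Comp Tk [:: search_code Tk; Proj 0]]) => p ex_k.
pose O := join_oracle alpha p.
have eval_qc n : eval O qc [:: n] (alpha n).
  apply: eval_comp1 (eval_double _ _) _; have := eval_Oracle O n.*2 [::].
  by rewrite /O /join_oracle odd_double doubleK.
have eval_pc n : eval O pc [:: n] (p n).
  apply: eval_comp1 (eval_comp1 (eval_double _ _) (eval_Succ _ _ _)) _.
  have := eval_Oracle O n.*2.+1 [::].
  by rewrite /O /join_oracle /= odd_double /= uphalf_double.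
have eval_Tk k n : eval O Tk [:: k; n] (T [:: n; k; p k]).
  apply: eval_Comp (eval_lookup eval_qc [:: n; k; p k] tT).
  apply: evals_cons; first exact: (@eval_Proj _ 1 [:: k; n]).
  apply: evals_cons; first exact: (@eval_Proj _ 0 [:: k; n]).
  apply: evals_cons (evals_nil _ _); apply: eval_comp1 (eval_pc _).
  exact: (@eval_Proj _ 0 [:: k; n]).
pose kmin n := ex_minn (ex_k n).
exists (fun n => (T [:: n; kmin n; p (kmin n)]).-1) => n; last first.
  exists (kmin n); rewrite /kmin; case: ex_minnP => k k0 _.
  by rewrite prednK // lt0n.
apply: eval_comp1 (eval_pred _ _); apply: eval_Comp (eval_Tk _ _).
apply: evals_cons.
  rewrite /kmin; case: ex_minnP => k k0 kmin'.
  apply: (@eval_search _ _ _ (fun m => T [:: n; m; p m])) => // m mk.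
  by apply/eqP; apply: contraTT mk => /kmin'; rewrite -leqNgt.
by apply: evals_cons (evals_nil _ _); exact: (@eval_Proj _ 0 [:: n]).
Qed.

End oracle_computability.

(** * The equivalence *)

Section presentations.
Context {R : realType} {X : topologicalType}.

Lemma polish_presentation : polish R X -> [set: X] !=set0 ->
  exists P : presentation R X, [/\ is_metric (dist P), compatible (dist P),
    complete_metric (dist P) & dense (range (pt P))].
Proof.
move=> [[d [dm dc dcompl]] [A /countable_injP[f finj] Adense]] [x0 _].
(* The countable dense set is enumerated by inverting its injection into [nat], with [x0] at the
   numbers not attained. *)
exists (Presentation d (fun n => xget x0 [set x | A x /\ f x = n])); split=> //=.
move=> O O0 oO; have [x [Ox Ax]] := Adense O O0 oO; exists x; split=> //.
exists (f x) => //; have : exists y, A y /\ f y = f x by exists x.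
by move=> /(@xgetPex _ x0)[Ay fy]; apply: finj; rewrite ?inE.
Qed.

Context (P : presentation R X).
Hypotheses (dm : is_metric (dist P)) (dc : compatible (dist P)).

(** Truncate the distance multiplied by [2 ^ k]. The denominator is a successor because
    [computable_dist] adds one to it. *)
Lemma dist_numerator m n k : exists a : nat,
  `|dist P (pt P m) (pt P n) - a%:R / (2 ^ k).-1.+1%:R| < 2 ^- k.
Proof.
set r := dist P _ _; have r0 : 0 <= r := dist_ge0 dm _ _.
have k0 : 0 < 2 ^+ k :> R by rewrite exprn_gt0.
have /truncn_itv/andP[lo hi] : 0 <= r * 2 ^+ k by rewrite mulr_ge0// ltW.
exists (Num.truncn (r * 2 ^+ k)); rewrite prednK ?expn_gt0// natrX.
have -> : r - (Num.truncn (r * 2 ^+ k))%:R / 2 ^+ k =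
    (r * 2 ^+ k - (Num.truncn (r * 2 ^+ k))%:R) / 2 ^+ k.
  by rewrite mulrBl mulfK// gt_eqF.
rewrite ger0_norm; last by rewrite divr_ge0 ?subr_ge0// ltW.
by rewrite ltr_pdivrMr// mulVf ?gt_eqF// ltrBlDl natr1.
Qed.

Definition ball_code := (nat * nat * nat)%type.

Definition rational_ball (b : ball_code) :=
  [set x | dist P (pt P b.1.1) x < b.1.2%:R / b.2.+1%:R].

(* The other indices give a ball of radius 0, hence empty. *)
Definition disjoint_ball (A : set X) (n : nat) : ball_code :=
  if unpickle n is Some b then
    if `[< forall x, rational_ball b x -> ~ A x >] then b else (0, 0, 0)%N
  else (0, 0, 0)%N.

(** Rational balls form a base, so those disjoint from [A] exhaust its complement. *)
Lemma closed_disjoint_balls (A : set X) : dense (range (pt P)) -> closed A ->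
  A = ~` \bigcup_n rational_ball (disjoint_ball A n).
Proof.
move=> dd clA.
have empty : rational_ball (0, 0, 0)%N = set0.
  apply/seteqP; split=> // x; rewrite /rational_ball /= mul0r.
  by rewrite ltNge (dist_ge0 dm).
apply/seteqP; split=> [x Ax [n _]|x xn].
  rewrite /disjoint_ball; case: unpickle => [b|]; last by rewrite empty.
  by case: asboolP => [bA /bA|_]; [|rewrite empty].
apply: contrapT => nAx.
have /(open_distP dc)/(_ x nAx)[r r0 rA] : open (~` A) by exact: closed_openC.
have [|n nr] := @half_pow_lt R (r / 2); first by rewrite divr_gt0.
have [a ax] := dense_approx dm dc dd x (@pow_half_gt0 R n).
have radius : 1%:R / (2 ^ n).-1.+1%:R = 2 ^- n :> R.
  by rewrite prednK ?expn_gt0// natrX mul1r.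
pose b : ball_code := (a, 1, (2 ^ n).-1)%N.
apply: xn; exists (pickle b) => //; rewrite /disjoint_ball pickleK.
case: asboolP => [_|[]]; first by rewrite /rational_ball /= radius.
move=> y; rewrite /rational_ball /= radius => ay; apply: rA.
by have := dist_triangle dm (pt P a) x y; rewrite (distC dm x (pt P a)); lra.
Qed.

End presentations.

Section encoding.
Context {R : realType} {X Y : topologicalType}.
Context (P : presentation R X) (Q : presentation R Y).
Hypotheses (dm : is_metric (dist P)) (dc : compatible (dist P)).
Hypothesis (dd : dense (range (pt P))).
Hypotheses (em : is_metric (dist Q)) (ec : compatible (dist Q)).
Hypothesis (ed : dense (range (pt Q))).

(** When entry [k] of a name of [x] is [a], entry [n] of a name of [h x] may be [b]. The factor 2
    accommodates the non-strict bound of [name_le]. *)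
Definition modulus_spec (A : set X) (h : X -> Y) n k a b :=
  forall x, A x -> dist P (pt P a) x < 2 ^- k * 2 ->
    dist Q (pt Q b) (h x) < 2 ^- n.+1.

(* The value 0 of [T] means that no [b] exists. *)
Lemma modulus_exists A h : exists T : seq nat -> nat, forall n k a,
  (forall b, T [:: n; k; a] = b.+1 -> modulus_spec A h n k a b) /\
  ((exists b, modulus_spec A h n k a b) -> T [:: n; k; a] != 0%N).
Proof.
have ex (v : seq nat) : exists t,
    let n := nth 0%N v 0 in let k := nth 0%N v 1 in let a := nth 0%N v 2 in
    (forall b, t = b.+1 -> modulus_spec A h n k a b) /\
    ((exists b, modulus_spec A h n k a b) -> t != 0%N).
  move=> /=; have [[b bP]|no] := pselect (exists b, modulus_spec A h
      (nth 0%N v 0) (nth 0%N v 1) (nth 0%N v 2) b).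
    by exists b.+1; split=> // _ [<-].
  by exists 0%N.
by have [T TP] := choice ex; exists T => n k a; exact: TP [:: n; k; a].
Qed.

Lemma modulus_computable alpha A h T : continuous_on (dist P) (dist Q) A h ->
  (forall n k a,
    (forall b, T [:: n; k; a] = b.+1 -> modulus_spec A h n k a b) /\
    ((exists b, modulus_spec A h n k a b) -> T [:: n; k; a] != 0%N)) ->
  lookup_computable alpha T -> computable_on alpha P Q A h.
Proof.
move=> hA TP /lookup_Phi[c cP]; exists c => x Ax p px.
have [n|q cq qP] := cP p.
  (* Two errors below [2 ^- n.+2], from [b] to [h x] and from [h x] to [h y], add up to less than
     [2 ^- n.+1]. *)
  have n0 := @pow_half_gt0 R n.+2; have [s s0 sP] := hA x Ax _ n0.
  (* The point [y] is within [2 ^- k * 2] of the entry of the name and [x] within [2 ^- k], whence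
     the 3. *)
  have [|k ks] := @half_pow_lt R (s / 3); first by rewrite divr_gt0.
  exists k; apply: (TP _ _ _).2; have [b bx] := dense_approx em ec ed (h x) n0.
  exists b => y Ay ay.
  have xy : dist P x y < s.
    have := dist_triangle dm (pt P (p k)) x y; have := name_le dm dc k px.
    by rewrite (distC dm x (pt _ _)); lra.
  have := sP y Ay xy; have := dist_triangle em (h x) (pt Q b) (h y).
  by rewrite (@pow_halfS R n.+1); lra.
exists q => //; apply: (is_name_approx em ec) => n; have [k kq] := qP n.
apply: ((TP _ _ _).1 _ kq x Ax); apply: le_lt_trans (name_le dm dc k px) _.
by have := @pow_half_gt0 R k; lra.
Qed.

(** Tags 0 and 1 store the metric, 2 to 4 the balls disjoint from each piece, and 5 the moduli. The
    family is fixed before [alpha], so one oracle can serve both directions. *)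
Lemma encoding_exists (A : nat -> set X) (h : nat -> X -> Y) :
  (forall i, closed (A i)) ->
  (forall i, continuous_on (dist P) (dist Q) (A i) (h i)) ->
  exists fam : nat * nat -> seq nat -> nat, forall alpha,
    (forall i, lookup_computable alpha (fam i)) ->
    [/\ computable_dist alpha P, forall i, Pi01 alpha P (A i) &
        forall i, computable_on alpha P Q (A i) (h i)].
Proof.
move=> clA hA.
have ex_num (v : seq nat) := dist_numerator dm
  (nth 0%N v 0) (nth 0%N v 1) (nth 0%N v 2).
have [num numP] := choice ex_num.
have [T TP] := choice (fun i => modulus_exists (A i) (h i)).
pose ball i v := disjoint_ball P (A i) (head 0%N v).
exists (fun ti v => match ti.1 with
  | 0 => num v
  | 1 => (2 ^ nth 0 v 2).-1
  | 2 => (ball ti.2 v).1.1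
  | 3 => (ball ti.2 v).1.2
  | 4 => (ball ti.2 v).2
  | _ => T ti.2 v
  end)%N => alpha fam; split=> [|i|i].
- exists (fun l m k => num [:: l; m; k]), (fun l m k => (2 ^ k).-1)%N; split.
  + exact: lookup_computable3 (fam (0, 0)%N).
  + exact: lookup_computable3 (fam (1, 0)%N).
  + by move=> m n k; exact: numP [:: m; n; k].
- exists (fun n => (disjoint_ball P (A i) n).1.1),
    (fun n => (disjoint_ball P (A i) n).1.2),
    (fun n => (disjoint_ball P (A i) n).2); split.
  + exact: lookup_computable1 (fam (2, i)%N).
  + exact: lookup_computable1 (fam (3, i)%N).
  + exact: lookup_computable1 (fam (4, i)%N).
  + exact: closed_disjoint_balls.
- exact: modulus_computable (hA i) (TP i) (fam (5, i)%N).
Qed.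

End encoding.

Section Borel_to_degrees.
Context {R : realType} {X Y : topologicalType}.
Context (P : presentation R X) (Q : presentation R Y).
Hypotheses (dm : is_metric (dist P)) (dc : compatible (dist P)).
Hypotheses (dcompl : complete_metric (dist P)) (dd : dense (range (pt P))).
Hypotheses (em : is_metric (dist Q)) (ec : compatible (dist Q)).

(** On a copy of [X], the second component of [f] is injective where the first one is constant.
    These parts are F_sigma as preimages of copies of [Y], and [jayne_rogers_inj] applies to their
    closed pieces. *)
Lemma first_level_Borel_pieces (f : nat * X -> nat * Y) :
  injective f -> first_level_Borel f ->
  exists (A : nat -> set X) (h : nat -> X -> Y),
    [/\ forall i, closed (A i),
        forall i, continuous_on (dist P) (dist Q) (A i) (h i) &
        forall m x, exists2 i, A i x & h i x = (f (m, x)).2].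
Proof.
move=> finj fB; pose h m x := (f (m, x)).2.
have slice m n (B : set Y) : Fsigma B ->
    Fsigma [set x | (f (m, x)).1 = n /\ B (h m x)].
  move=> FB; have : Fsigma [set p | p.1 = n /\ B p.2].
    apply/Fsigma_nat_prodP => j; have [->|jn] := eqVneq j n.
      by rewrite (_ : mkset _ = B)//; apply/seteqP; split=> [y []|].
    apply: closed_Fsigma; rewrite (_ : mkset _ = set0); first exact: closed0.
    by apply/seteqP; split=> // y [/= jn']; rewrite jn' eqxx in jn.
  by move=> /fB /Fsigma_nat_prodP /(_ m).
have pw m : piecewise_continuous_on (dist P) (dist Q) setT (h m).
  have /(_ _)/cid2-/all_sig2[F clF FE] : forall n, Fsigma [set x | (f (m, x)).1 = n].
    move=> n; have := slice m n setT (closed_Fsigma closedT).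
    by congr Fsigma; apply/seteqP; split=> [x []|].
  apply: (@piecewise_continuous_subset _ _ _ _ _ _
      (\bigcup_(p : nat * nat) F p.1 p.2)).
    move=> x _; have : [set y | (f (m, y)).1 = (f (m, x)).1] x by [].
    by rewrite FE => -[j _ Fx]; exists ((f (m, x)).1, j).
  apply: piecewise_continuous_bigcup => -[n j] /=.
  have Fn x : F n j x -> (f (m, x)).1 = n.
    move=> Fx; have : (\bigcup_j F n j) x by exists j.
    by rewrite -FE.
  apply: (jayne_rogers_inj dm dc dcompl em ec dd) => //.
    move=> x y /Fn xn /Fn yn hxy; have : f (m, x) = f (m, y).
      by apply: injective_projections; rewrite ?xn.
    by move=> /finj[].
  move=> B /(slice m n) FB.
  suff -> : F n j `&` h m @^-1` B =
      F n j `&` [set x | (f (m, x)).1 = n /\ B (h m x)].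
    by apply: FsigmaI => //; exact: closed_Fsigma.
  by apply/seteqP; split=> [x [Fx Bx]|x [Fx [_ Bx]]]; do ?split=> //; exact: Fn.
have [F FP] := choice pw.
exists (fun k => if unpickle k is Some (m, l) then F m l else set0),
  (fun k => if @unpickle (nat * nat)%type k is Some (m, l) then h m else h 0%N).
split=> [k|k|m x].
- by case: unpickle => [[m l]|]; [have [] := FP m|exact: closed0].
- by case: unpickle => [[m l]|]; [have [] := FP m|move=> ? []].
- have [_ _ /(_ x I)[l _ Fx]] := FP m.
  by exists (pickle (m, l)); rewrite pickleK.
Qed.

End Borel_to_degrees.

Section degrees_to_Borel.
Context {R : realType} {X Y : topologicalType}.
Context (d : X -> X -> R) (e : Y -> Y -> R).
Hypotheses (dm : is_metric d) (dc : compatible d).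
Hypotheses (em : is_metric e) (ec : compatible e).

(** The composite of [h] and [k] is continuous on the closed set of points of [A] mapped into [B],
    so its fixed points there form a closed set. *)
Lemma closed_mutually_inverse (A : set X) (B : set Y) h k :
  closed A -> continuous_on d e A h -> closed B -> continuous_on e d B k ->
  closed [set x | [/\ A x, B (h x) & k (h x) = x]].
Proof.
move=> clA hA clB kB; apply/(closed_distP dc) => x xcl.
have [Ax Bhx] : (A `&` h @^-1` B) x.
  move: (closed_preimage_on dc ec clA hA clB) => /(closed_distP dc); apply.
  by move=> r /xcl[y [Ay By _]]; exists y.
split=> //; apply: contrapT => /(dist_gt0 dm) kx.
have r0 : 0 < d (k (h x)) x / 2 by rewrite divr_gt0.
have [s s0 sP] := kB (h x) Bhx _ r0; have [t t0 tP] := hA x Ax s s0.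
have [|y [Ay By ky]] := xcl (Num.min t (d (k (h x)) x / 2)).
  by rewrite lt_min t0.
rewrite lt_min => /andP[xt xr].
have := sP _ By (tP y Ay xt); rewrite ky.
by have := dist_triangle dm y (k (h x)) x; rewrite (distC dm y x); lra.
Qed.

End degrees_to_Borel.

(** For each pair of indices, [h i] and [k j] are restricted to the closed sets where they invert
    each other. This gives families of homeomorphic pieces with a common index. *)
Lemma mutually_inverse_families_Borel {R : realType} {X Y : topologicalType}
    (d : X -> X -> R) (e : Y -> Y -> R)
    (A : nat -> set X) (B : nat -> set Y) (h : nat -> X -> Y) (k : nat -> Y -> X) :
  is_metric d -> compatible d -> is_metric e -> compatible e ->
  (forall i, closed (A i)) -> (forall i, continuous_on d e (A i) (h i)) ->
  (forall i, closed (B i)) -> (forall i, continuous_on e d (B i) (k i)) ->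
  (forall x, exists i j, [/\ A i x, B j (h i x) & k j (h i x) = x]) ->
  (forall y, exists i j, [/\ B j y, A i (k j y) & h i (k j y) = y]) ->
  first_level_Borel_isomorphic (nat * X)%type (nat * Y)%type.
Proof.
move=> dm dc em ec clA hA clB kB coverX coverY.
pose idx n := odflt (0, 0)%N (@unpickle (nat * nat)%type n).
have idxE i j : idx (pickle (i, j)) = (i, j) by rewrite /idx pickleK.
pose h' n := h (idx n).1; pose k' n := k (idx n).2.
pose A' n := [set x | [/\ A (idx n).1 x, B (idx n).2 (h' n x) & k' n (h' n x) = x]].
pose B' n := [set y | [/\ B (idx n).2 y, A (idx n).1 (k' n y) & h' n (k' n y) = y]].
have clA' n : closed (A' n) by exact: (closed_mutually_inverse dm dc ec).
have clB' n : closed (B' n) by exact: (closed_mutually_inverse em ec dc).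
have coverA x : exists n, A' n x.
  by have [i [j ij]] := coverX x; exists (pickle (i, j)); rewrite /A' /h' /k' /= idxE.
have coverB y : exists n, B' n y.
  by have [i [j ij]] := coverY y; exists (pickle (i, j)); rewrite /B' /h' /k' /= idxE.
exists (piecewise_map A' B' h'), (piecewise_map B' A' k'); split.
- by apply: piecewise_mapK => // n x [Ax Bx kx]; rewrite /B' /= kx.
- by apply: piecewise_mapK => // n y [By Ay hy]; rewrite /A' /= hy.
- apply: (piecewise_map_first_level dm dc ec clA' _ coverA) => [n|c j].
    by apply: continuous_on_subset (hA (idx n).1) => x [].
  exact: (Fsigma_rank_members em ec).
- apply: (piecewise_map_first_level em ec dc clB' _ coverB) => [n|c j].
    by apply: continuous_on_subset (kB (idx n).2) => y [].
  exact: (Fsigma_rank_members dm dc).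
Qed.

Theorem theorem2p3 (R : realType) (X Y : topologicalType)
    (polishX : polish R X) (polishY : polish R Y)
    (X_neq0 : [set: X] !=set0) (Y_neq0 : [set: Y] !=set0) :
  first_level_Borel_isomorphic (nat * X)%type (nat * Y)%type <->
  exists alpha : nat -> bool,
  exists (P : presentation R X) (Q : presentation R Y),
    [/\ computable_polish_space alpha P, computable_polish_space alpha Q &
        same_tt_degrees alpha P Q].
Proof.
split; last first.
  move=> [alpha [P [Q [[[dm dc dd _] _] [[em ec ed _] _] [XY YX]]]]].
  have [[x0 _] [y0 _]] := (X_neq0, Y_neq0).
  have [A [h [clA hA Ah]]] := tt_le_family alpha dm dc dd em ec y0.
  have [B [k [clB kB Bk]]] := tt_le_family alpha em ec ed dm dc x0.
  apply: (mutually_inverse_families_Borel dm dc em ec clA hA clB kB).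
    (* The two reductions between [x] and an equivalent [y] are mutually inverse at these points. *)
    move=> x; have [y [/Bk[j Bj kj] /Ah[i Ai hi]]] := XY x.
    by exists i, j; rewrite hi.
  move=> y; have [x [/Bk[j Bj kj] /Ah[i Ai hi]]] := YX y.
  by exists i, j; rewrite kj.
move=> [f [g [fK gK fB gB]]].
have [P [dm dc dcompl dd]] := polish_presentation polishX X_neq0.
have [Q [em ec ecompl ed]] := polish_presentation polishY Y_neq0.
have [A [h [clA hA Ah]]] :=
  first_level_Borel_pieces dm dc dcompl dd em ec (can_inj fK) fB.
have [B [k [clB kB Bk]]] :=
  first_level_Borel_pieces em ec ecompl ed dm dc (can_inj gK) gB.
have [famX famXP] := encoding_exists dm dc dd em ec ed clA hA.
have [famY famYP] := encoding_exists em ec ed dm dc dd clB kB.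
(* The boolean tag merges the data of both directions into a single oracle. *)
have [alpha alphaP] := encodes_exists
  (fun t : bool * (nat * nat) => if t.1 then famX t.2 else famY t.2).
have [distP PA hP] := famXP alpha (fun i => alphaP (true, i)).
have [distQ PB kP] := famYP alpha (fun i => alphaP (false, i)).
have tt_f m x n y : f (m, x) = (n, y) -> tt_equiv alpha P x Q y.
  move=> fx; have gy : g (n, y) = (m, x) by rewrite -fx fK.
  have [i Ai hi] := Ah m x; have [j Bj kj] := Bk n y.
  split; [exists (B j), (k j)|exists (A i), (h i)]; split=> //.
    by rewrite kj gy.
  by rewrite hi fx.
exists alpha, P, Q; split=> //; split=> [x|y].
  (* Any copy of [x] would do; copy 0 is used. *)
  exists (f (0%N, x)).2; apply: (@tt_f 0%N x (f (0%N, x)).1).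
  exact: surjective_pairing.
exists (g (0%N, y)).2; apply: (@tt_f (g (0%N, y)).1 _ 0%N).
by rewrite -surjective_pairing gK.
Qed.
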